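(* Let $\beta\in\mathbb{C}$ with $\beta\notin\mathbb{Z}+1/2$ and let $$\phi^{(1,\beta)}(e^{i\theta})=t_{\beta-1/2}(e^{i\theta})\,t_{\beta+1/2}(e^{i(\theta-\pi)}).$$ Then, as $n\to\infty$, $$\det M_n(\phi^{(1,\beta)})\sim n^{-1/4-3\beta^2}\,2^{4\beta^2}\,G(1-2\beta)\,G(1/2+\beta)\,G(3/2+\beta).$$ Moreover, $\det M_n(\phi^{(1,\beta)})=0$ if and only if $\beta\in\{1,2,3,\dots\}$ and $n\ge 2\beta+1$.
   Context: $\phi_k=\frac1{2\pi}\int_0^{2\pi}\phi(e^{i\theta})e^{-ik\theta}d\theta$ is the $k$-th Fourier coefficient, and $M_n(\phi)=(\phi_{j-k}+\phi_{j+k+1})_{j,k=0}^{n-1}$. For $\beta\in\mathbb{C}$, $t_\beta(e^{i\theta})=\exp(i\beta(\theta-\pi))$ for $0<\theta<2\pi$; $t_\beta(e^{i(\theta-\pi)})$ is the value of $t_\beta$ at the point $e^{i(\theta-\pi)}$. $G(\cdot)$ is the Barnes G-function, $G(1+z)=(2\pi)^{z/2}e^{-(z+1)z/2-\gamma_E z^2/2}\prod_{k=1}^\infty\left((1+z/k)^k e^{-z+z^2/(2k)}\right)$, with $\gamma_E$ Euler's constant. $a_n\sim c_n$ means $a_n=c_n(1+o(1))$ as $n\to\infty$ (so if $c_n=0$ for all $n$, then $a_n=0$ for all large $n$). *)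

(* Defs.v *)
From HB Require Import structures.
From mathcomp Require Import all_boot all_order all_algebra.
From mathcomp Require Import all_classical all_reals all_analysis.
From mathcomp Require Import complex.

Set Implicit Arguments.
Unset Strict Implicit.
Unset Printing Implicit Defensive.

Import Order.TTheory GRing.Theory Num.Theory.
Import numFieldTopology.Exports numFieldNormedType.Exports.

Local Open Scope classical_set_scope.
Local Open Scope complex_scope.
Local Open Scope ring_scope.

Section Defs.
Variable R : realType.
Implicit Types (z w b : R[i]) (x y : R) (n : nat).

Definition cexp z : R[i] :=
  (expR (complex.Re z))%:C * (cos (complex.Im z) +i* sin (complex.Im z)).

Definition expi x : R[i] := cexp (0 +i* x).

(* Principal power of a real base; meaningful for 0 < x only. *)
Definition cpow x w : R[i] := cexp (w * (ln x)%:C).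

(* The angle of a point of the unit circle in the open interval ]0, 2 pi[;
   the point 1 has no such angle and receives the junk value 0 (the value of a
   symbol at a single point does not affect its Fourier coefficients). *)
Definition angle z : R :=
  xget 0 [set x : R | 0 < x < 2 * pi /\ expi x = z].

(* t_b (e^{i x}) = exp (i b (x - pi)) for 0 < x < 2 pi. *)
Definition tsym b z : R[i] := cexp ((0 +i* 1) * b * (angle z - pi)%:C).

(* At z = e^{i x}, the factor z * expi (- pi) is the point e^{i (x - pi)}. *)
Definition phi1 b z : R[i] :=
  tsym (b - 1 / 2) z * tsym (b + 1 / 2) (z * expi (- pi)).

Definition cintegral (D : set R) (f : R -> R[i]) : R[i] :=
  (\int[lebesgue_measure]_(x in D) complex.Re (f x))
  +i* (\int[lebesgue_measure]_(x in D) complex.Im (f x)).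

Definition fourier (phi : R[i] -> R[i]) (k : int) : R[i] :=
  ((2 * pi)^-1)%:C *
  cintegral `[0, 2 * pi] (fun x => phi (expi x) * expi (- (k%:~R * x))).

Definition Mmx (phi : R[i] -> R[i]) n : 'M[R[i]]_n :=
  \matrix_(j < n, k < n)
    (fourier phi (j%:Z - k%:Z) + fourier phi (j%:Z + k%:Z + 1)).

Definition euler_gamma : R :=
  limn (fun n => (\sum_(1 <= k < n.+1) (k%:R : R)^-1) - ln n%:R).

(* R[i]^o is R[i] with the topology of its modulus.
   The infinite product in the formula for G (1 + z). *)
Definition barnes_prod z : R[i] :=
  limn (fun n => \prod_(1 <= k < n.+1)
    ((1 + z / k%:R) ^+ k * cexp (- z + z ^+ 2 / (2 * k%:R))) : R[i]^o).

Definition barnesG1p z : R[i] :=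
  cpow (2 * pi) (z / 2)
  * cexp (- ((z + 1) * z / 2) - euler_gamma%:C * z ^+ 2 / 2)
  * barnes_prod z.

Definition barnesG w : R[i] := barnesG1p (w - 1).

(* a_n = c_n (1 + o(1)); the terms of c are allowed to vanish. *)
Definition asymp (a c : nat -> R[i]) : Prop :=
  exists2 e : nat -> R[i], e n @[n --> \oo] --> (0 : R[i]^o)
    & \forall n \near \oo, a n = c n * (1 + e n).

End Defs.

(* Main.v *)
Require Import Defs.
From mathcomp Require Import all_boot all_order all_algebra.
From mathcomp Require Import all_classical all_reals all_analysis.
From mathcomp Require Import complex.
From mathcomp Require Import ring lra zify.

Set Implicit Arguments.
Unset Strict Implicit.
Unset Printing Implicit Defensive.

Import Order.TTheory GRing.Theory Num.Theory.
Import numFieldTopology.Exports numFieldNormedType.Exports.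
Import Normc.

Local Open Scope classical_set_scope.
Local Open Scope complex_scope.
Local Open Scope ring_scope.

(** The symbol is a pure exponential on each half of the circle, so its Fourier
    coefficients are explicit: with [b = 2 beta], they vanish for even [k] and equal
    [c / (k - b)] for odd [k], where [c = 2 cos (pi beta) / pi] ([fourier_even],
    [fourier_odd]).  Exactly one of [j - k] and [j + k + 1] is odd, so every entry of
    the matrix is a single fraction, and up to the row signs [(-1)^j] the matrix is
    the Cauchy matrix [1 / (x_j + y_k)] with [x_j = (-1)^j (j + 1/2 - b)] and
    [y_k = (-1)^k (k + 1/2)].  Hence the determinant is an explicit product
    ([cauchy_det_step], [detM_step]).

    Vanishing.  Since [c] and the [y_j - y_k] are nonzero, the determinant vanishes
    exactly when two of the [x_j] with [j < n] coincide, that is when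
    [j + k + 1 = 2 b] for some [j < k < n] of different parities; this says
    [beta = m] with [m >= 1] and [4 m = j + k + 1 <= 2 n - 2] ([detM_eq0]).

    Asymptotics.  The constant [c] is itself an infinite product, the limit of
    [costrunc b K = (2K+1) prod_(k <= K) ((2k-1)^2 - b^2) / (2k)^2]: this combines
    the Wallis product and the product for the cosine ([costrunc_cosconst]).  With
    [K] the integer part of [n/2], writing [c^n] as [(c / costrunc b K)^n] times
    [(costrunc b K)^n] makes almost all factors of the determinant cancel
    ([detM_closed]).  What remains is
    [prod_(k <= K) ((1 - 2 beta/k) (1 + (beta - 1/2)/k) (1 + (beta + 1/2)/k))^k],
    together with four groups of powers whose bases are close to [1].  The product is a
    truncation of [G(1 - 2 beta) G(1/2 + beta) G(3/2 + beta)], up to an exponential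
    of harmonic numbers: the three parameters [-2 beta], [beta - 1/2], [beta + 1/2]
    have sum [0] and their squares have sum [6 beta^2 + 1/2], so the powers of
    [2 pi] cancel and only [(3 beta^2 + 1/4) (H_K - gamma - 1)] is left in the
    exponent ([three_barnes]).  Each of the four groups is an elementary exponential
    times a factor tending to [1] ([cvg_cratio], [cvg_oddD_pow], [cvg_oddB_pow],
    [cvg_hfac]), and the exponents add up to the stated power of [n] and of [2]
    ([expo_diff_cvg]).  The determinant and its equivalent are compared
    through their common factor, without dividing by it; this covers the integers
    [beta >= 1], for which both vanish. *)

(** * The modulus and the exponential *)

Section Modulus.
Variable R : realType.
Implicit Types (z w : R[i]) (x y : R).

Lemma normc_ge0 z : 0 <= normc z.
Proof. by case: z => a b /=; exact: sqrtr_ge0. Qed.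

Lemma normcD_le z w : normc (z + w) <= normc z + normc w.
Proof. exact: le_normcD. Qed.

Lemma normcN1 z : normc (- z) = normc z.
Proof. exact: normcN. Qed.

Lemma normcB_le z w : normc (z - w) <= normc z + normc w.
Proof. by apply: le_trans (normcD_le _ _) _; rewrite normcN1. Qed.

Lemma normcB_ge z w : normc z - normc w <= normc (z - w).
Proof. by rewrite lerBlDr -{1}[z](subrK w); exact: normcD_le. Qed.

Lemma normc_real x : normc x%:C = `|x|.
Proof. by rewrite /= expr0n /= addr0 sqrtr_sqr. Qed.

Lemma natC n : (n%:R : R[i]) = (n%:R : R)%:C.
Proof. by rewrite rmorph_nat. Qed.

Lemma normc_nat n : normc (n%:R : R[i]) = n%:R.
Proof. by rewrite natC normc_real ger0_norm. Qed.

Lemma normcX z n : normc (z ^+ n) = normc z ^+ n.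
Proof. by elim: n => [|n IH]; rewrite ?expr0 ?normc1 // !exprS normcM IH. Qed.

Lemma normc_eq0 z : (normc z == 0) = (z == 0).
Proof. by apply/eqP/eqP => [/eq0_normc //|->]; exact: normc0. Qed.

Lemma normc_gt0 z : (0 < normc z) = (z != 0).
Proof. by rewrite lt_def normc_eq0 normc_ge0 andbT. Qed.

Lemma Re_le_normc z : `|complex.Re z| <= normc z.
Proof.
case: z => a b /=; rewrite -(@ler_pXn2r _ 2) ?nnegrE ?sqrtr_ge0 //.
by rewrite sqr_sqrtr ?addr_ge0 ?sqr_ge0 // -normrX ger0_norm ?sqr_ge0 // lerDl sqr_ge0.
Qed.

Lemma Im_le_normc z : `|complex.Im z| <= normc z.
Proof.
case: z => a b /=; rewrite -(@ler_pXn2r _ 2) ?nnegrE ?sqrtr_ge0 //.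
by rewrite sqr_sqrtr ?addr_ge0 ?sqr_ge0 // -normrX ger0_norm ?sqr_ge0 // lerDr sqr_ge0.
Qed.

Lemma normc_le_ReIm z : normc z <= `|complex.Re z| + `|complex.Im z|.
Proof.
case: z => a b /=; rewrite -(@ler_pXn2r _ 2) ?nnegrE ?sqrtr_ge0 ?addr_ge0 //.
rewrite sqr_sqrtr ?addr_ge0 ?sqr_ge0 // sqrrD !real_normK ?num_real //.
by rewrite addrAC lerDl mulrn_wge0 // mulr_ge0.
Qed.

Lemma cvgC_normc (T : Type) (F : set_system T) {FF : Filter F} (u : T -> R[i]^o)
    (l : R[i]^o) :
  (normc (u t - l) @[t --> F] --> (0 : R)) -> u t @[t --> F] --> l.
Proof.
move=> /cvgrPdist_lt h; apply/cvgrPdist_lt => e.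
rewrite ltcE /= => /andP[/eqP e0 epos].
near=> t; rewrite distrC.
have : normc (u t - l) < complex.Re e.
  near: t; have := h _ epos; apply: filterS => t.
  by rewrite sub0r normrN ger0_norm // normc_ge0.
by rewrite ltcE /= e0 eqxx.
Unshelve. all: by end_near. Qed.

Lemma normc_cvg0 (T : Type) (F : set_system T) {FF : Filter F} (u : T -> R[i]^o)
    (l : R[i]^o) :
  u t @[t --> F] --> l -> normc (u t - l) @[t --> F] --> (0 : R).
Proof.
move=> /cvgrPdist_lt h; apply/cvgrPdist_lt => e e0.
have eC : (0 : R[i]) < e%:C by rewrite ltcR.
have := h _ eC; apply: filterS => t; rewrite distrC ltcE /= => /andP[_].
by rewrite sub0r normrN ger0_norm // normc_ge0.
Qed.

Lemma normc_cvg_le (u : nat -> R[i]^o) (l : R[i]^o) (d : nat -> R) :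
  (\forall n \near \oo, normc (u n - l) <= d n) -> d n @[n --> \oo] --> (0 : R) ->
  u n @[n --> \oo] --> l.
Proof.
move=> h d0; apply: cvgC_normc.
apply: (@squeeze_cvgr _ _ _ _ (fun=> 0) d) => //; last exact: cvg_cst.
by apply: filterS h => n -> ; rewrite normc_ge0.
Qed.

Lemma cvgC_real (u : nat -> R) (l : R) :
  u n @[n --> \oo] --> l -> ((u n)%:C : R[i]^o) @[n --> \oo] --> (l%:C : R[i]^o).
Proof.
move=> h; apply: cvgC_normc.
have h0 : u n - l @[n --> \oo] --> (0 : R).
  by rewrite -(subrr l); apply: cvgB => //; exact: cvg_cst.
rewrite (_ : (fun n => _) = (fun n => `|u n - l|)).
  by rewrite -(@normr0 _ R); exact: cvg_norm h0.
by apply/funext => n; rewrite -rmorphB normc_real.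
Qed.

(** Both real parts and imaginary parts form Cauchy sequences, so the
    completeness of the reals suffices. *)
Lemma cvgC_cauchy (u : nat -> R[i]^o) (d : nat -> R) (N : nat) :
  (forall n m, (N <= n)%N -> (n <= m)%N -> normc (u m - u n) <= d n) ->
  d n @[n --> \oo] --> (0 : R) ->
  exists l : R[i]^o, u n @[n --> \oo] --> l.
Proof.
move=> h d0.
have key (p : R[i] -> R) : (forall a b, p (a - b) = p a - p b) ->
    (forall z, `|p z| <= normc z) -> cvgn (p \o u).
  move=> pB ple; apply: cauchy_cvg; apply: cauchy_exP => e e0.
  have /cvgrPdist_lt/(_ e e0) [M _ hM] := d0.
  pose k := maxn N M; exists (p (u k)).
  exists k => // n kn; rewrite /ball /= -opprB normrN -pB.
  apply: le_lt_trans (ple _) _; apply: le_lt_trans (h k n _ kn) _.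
    exact: leq_maxl.
  have := hM k (leq_maxr _ _); rewrite /= sub0r normrN; apply: le_lt_trans.
  exact: ler_norm.
have /cvg_ex[a ua] : cvgn (fun n => complex.Re (u n)).
  by apply: (key (@complex.Re R)) => [[? ?] [? ?]|z] //; exact: Re_le_normc.
have /cvg_ex[b ub] : cvgn (fun n => complex.Im (u n)).
  by apply: (key (@complex.Im R)) => [[? ?] [? ?]|z] //; exact: Im_le_normc.
exists (a +i* b).
apply: (@normc_cvg_le _ _ (fun n => `|complex.Re (u n) - a| + `|complex.Im (u n) - b|)).
  by apply: nearW => n; case: (u n) => x y; exact: normc_le_ReIm.
have ab0 (v : nat -> R) (l : R) : v n @[n --> \oo] --> l ->
    `|v n - l| @[n --> \oo] --> (0 : R).
  move=> hv; rewrite -(@normr0 _ R); apply: cvg_norm.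
  by rewrite -(subrr l); apply: cvgB => //; exact: cvg_cst.
by rewrite -(addr0 (0 : R)); apply: cvgD; apply: ab0.
Qed.

Lemma ReD z w : complex.Re (z + w) = complex.Re z + complex.Re w.
Proof. by case: z w => ? ? []. Qed.

Lemma ImD z w : complex.Im (z + w) = complex.Im z + complex.Im w.
Proof. by case: z w => ? ? []. Qed.

Lemma ReM z w :
  complex.Re (z * w) = complex.Re z * complex.Re w - complex.Im z * complex.Im w.
Proof. by case: z w => ? ? []. Qed.

Lemma ImM z w :
  complex.Im (z * w) = complex.Re z * complex.Im w + complex.Im z * complex.Re w.
Proof. by case: z w => ? ? []. Qed.

Lemma complex_ext z w :
  complex.Re z = complex.Re w -> complex.Im z = complex.Im w -> z = w.
Proof. by case: z w => ? ? [? ?] /= -> ->. Qed.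

Lemma cexpD z w : cexp (z + w) = cexp z * cexp w.
Proof.
apply: complex_ext; rewrite /cexp !(ReM, ImM, ReD, ImD) /= expRD cosD sinD; ring.
Qed.

Lemma cexp0 : cexp (0 : R[i]) = 1.
Proof. by rewrite /cexp /= expR0 cos0 sin0 mul1r. Qed.

Lemma cexp_mulN z : cexp z * cexp (- z) = 1.
Proof. by rewrite -cexpD subrr cexp0. Qed.

Lemma cexp_neq0 z : cexp z != 0.
Proof.
by apply/eqP => h; have := cexp_mulN z; rewrite h mul0r => /esym/eqP; rewrite oner_eq0.
Qed.

Lemma cexpN z : cexp (- z) = (cexp z)^-1.
Proof. by apply: (mulfI (cexp_neq0 z)); rewrite cexp_mulN mulfV ?cexp_neq0. Qed.

Lemma cexp_natM n z : cexp (n%:R * z) = cexp z ^+ n.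
Proof.
elim: n => [|n IH]; first by rewrite mul0r cexp0.
by rewrite -natr1 mulrDl mul1r cexpD IH exprSr.
Qed.

Lemma cexp_sum (I : Type) (r : seq I) (P : pred I) (F : I -> R[i]) :
  cexp (\sum_(i <- r | P i) F i) = \prod_(i <- r | P i) cexp (F i).
Proof. exact: (big_morph _ cexpD cexp0). Qed.

Lemma normc_cexp z : normc (cexp z) = expR (complex.Re z).
Proof.
rewrite /cexp normcM normc_real ger0_norm ?expR_ge0 //=.
by rewrite cos2Dsin2 sqrtr1 mulr1.
Qed.

Lemma normc_cexp_le z : normc (cexp z) <= expR (normc z).
Proof. by rewrite normc_cexp ler_expR; exact: le_trans (ler_norm _) (Re_le_normc _). Qed.

End Modulus.

(** * Derivatives of complex functions of a real variable *)

Section Derivative.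
Variable R : realType.
Implicit Types (F G : R -> R[i]) (f g z w : R[i]) (t x : R).

(** The functions differentiated here take values in the complex numbers but
    have a real argument; they are differentiated coordinatewise, which
    reduces everything to the real theory. *)
Definition isD F t f : Prop :=
  is_derive t (1 : R) (fun s => complex.Re (F s)) (complex.Re f) /\
  is_derive t (1 : R) (fun s => complex.Im (F s)) (complex.Im f).

Lemma isD_eq F t f g : isD F t f -> f = g -> isD F t g.
Proof. by move=> h <-. Qed.

Lemma isD_cst t z : isD (fun=> z) t 0.
Proof. by split; exact: is_derive_cst. Qed.

Lemma isD_real (u : R -> R) t d : is_derive t (1 : R) u d ->
  isD (fun s => (u s)%:C) t d%:C.
Proof. by move=> h; split => //=; exact: is_derive_cst. Qed.

Lemma isD_id t : isD (fun s => s%:C) t 1.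
Proof. exact: (isD_real (is_derive_id _ _)). Qed.

Lemma isD_add F G t f g : isD F t f -> isD G t g ->
  isD (fun s => F s + G s) t (f + g).
Proof.
move=> [F1 F2] [G1 G2]; split.
- rewrite ReD (_ : (fun s => _) = (fun s => complex.Re (F s)) + (fun s => complex.Re (G s))).
    exact: is_deriveD.
  by apply/funext => s; rewrite ReD.
- rewrite ImD (_ : (fun s => _) = (fun s => complex.Im (F s)) + (fun s => complex.Im (G s))).
    exact: is_deriveD.
  by apply/funext => s; rewrite ImD.
Qed.

Lemma isD_mul F G t f g : isD F t f -> isD G t g ->
  isD (fun s => F s * G s) t (f * G t + F t * g).
Proof.
move=> [F1 F2] [G1 G2]; split.
- rewrite (_ : (fun s => _) = (fun s => complex.Re (F s)) * (fun s => complex.Re (G s))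
     - (fun s => complex.Im (F s)) * (fun s => complex.Im (G s))).
    apply: is_derive_eq; rewrite ReD !ReM /GRing.scale /=; ring.
  by apply/funext => s; rewrite ReM.
- rewrite (_ : (fun s => _) = (fun s => complex.Re (F s)) * (fun s => complex.Im (G s))
     + (fun s => complex.Im (F s)) * (fun s => complex.Re (G s))).
    apply: is_derive_eq; rewrite ImD !ImM /GRing.scale /=; ring.
  by apply/funext => s; rewrite ImM.
Qed.

Lemma isD_scale z F t f : isD F t f -> isD (fun s => z * F s) t (z * f).
Proof.
by move=> h; apply: isD_eq (isD_mul (isD_cst t z) h) _; rewrite mul0r add0r.
Qed.

Lemma isD_opp F t f : isD F t f -> isD (fun s => - F s) t (- f).
Proof.
move=> /(isD_scale (-1)) h; move: h; rewrite mulN1r.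
by under eq_fun do rewrite mulN1r.
Qed.

Lemma isD_sub F G t f g : isD F t f -> isD G t g ->
  isD (fun s => F s - G s) t (f - g).
Proof. by move=> hF hG; exact: isD_add hF (isD_opp hG). Qed.

Lemma isD_cexp F t f : isD F t f -> isD (fun s => cexp (F s)) t (f * cexp (F t)).
Proof.
move=> [F1 F2].
have De := is_derive1_comp (is_derive_expR (complex.Re (F t))) F1.
have Dc := is_derive1_comp (is_derive_cos (complex.Im (F t))) F2.
have Ds := is_derive1_comp (is_derive_sin (complex.Im (F t))) F2.
split.
- rewrite (_ : (fun s => _) = (expR \o (fun s => complex.Re (F s)))
     * (cos \o (fun s => complex.Im (F s)))).
    apply: is_derive_eq; rewrite /cexp !(ReM, ImM) /GRing.scale /=; ring.
  by apply/funext => s; rewrite /cexp ReM /= mul0r subr0.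
- rewrite (_ : (fun s => _) = (expR \o (fun s => complex.Re (F s)))
     * (sin \o (fun s => complex.Im (F s)))).
    apply: is_derive_eq; rewrite /cexp !(ReM, ImM) /GRing.scale /=; ring.
  by apply/funext => s; rewrite /cexp ImM /= mul0r addr0.
Qed.

(** The factor 2 absorbs the fact that the mean value theorem gives different
    intermediate points for the two coordinates. *)
Lemma isD_mean_value F F' (a b M : R) : a <= b ->
  (forall t, isD F t (F' t)) -> (forall t, a <= t <= b -> normc (F' t) <= M) ->
  normc (F b - F a) <= 2 * M * (b - a).
Proof.
move=> ab hF hM.
have key (p : R[i] -> R) : (forall z w, p (z - w) = p z - p w) ->
    (forall z, `|p z| <= normc z) ->
    (forall t, is_derive t (1 : R) (p \o F) (p (F' t))) ->
    `|p (F b - F a)| <= M * (b - a).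
  move=> pB ple hd.
  rewrite pB; have cF : {within `[a, b], continuous (p \o F)}.
    by apply: derivable_within_continuous => t _; case: (hd t).
  have [c /[!in_itv]/= cab ->] :=
    @MVT_segment R (p \o F) (p \o F') a b ab (fun t _ => hd t) cF.
  rewrite normrM (ger0_norm (_ : 0 <= b - a)) ?subr_ge0 // ler_wpM2r ?subr_ge0 //.
  exact: le_trans (ple _) (hM _ cab).
apply: le_trans (normc_le_ReIm _) _.
rewrite -mulrA mulr_natl mulr2n; apply: lerD.
- by apply: (key (@complex.Re R)) => [[? ?] [? ?]|z|t] //; [exact: Re_le_normc|case: (hF t)].
- by apply: (key (@complex.Im R)) => [[? ?] [? ?]|z|t] //; [exact: Im_le_normc|case: (hF t)].
Qed.

End Derivative.

(** * Cauchy determinants *)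

Section CauchyDeterminant.
Variable F : fieldType.
Implicit Types (x y : nat -> F) (n : nat).

(** Eliminating the last column against the pivot [(x n + y n)^-1] turns the
    entry [(x i + y j)^-1] into itself times a factor depending on [i] only and
    a factor depending on [j] only. *)
Lemma cauchy_det_step x y n :
  (forall i j, (i <= n)%N -> (j <= n)%N -> x i + y j != 0) ->
  \det (\matrix_(i < n.+1, j < n.+1) (x i + y j)^-1) =
  \det (\matrix_(i < n, j < n) (x i + y j)^-1) *
  ((x n + y n)^-1 * \prod_(i < n)
     ((x i - x n) * (y i - y n) / ((x i + y n) * (x n + y i)))).
Proof.
move=> xy0.
pose f i j := (x i + y j)^-1.
(* The size is written n + 1 to allow a decomposition into blocks. *)
transitivity (\det (\matrix_(i < n + 1, j < n + 1) f i j)); first by rewrite addn1.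
set A := (X in \det X = _).
pose B := \matrix_(i < n, j < n) f i j.
pose v := \col_(i < n) (f i n); pose w := \row_(j < n) (f n j).
pose a := f n n.
have a0 : a != 0 by rewrite invr_eq0 xy0.
have AE : A = block_mx B v w a%:M.
  apply/matrixP => i j; rewrite !mxE.
  case: (split_ordP i) => i' ->; rewrite ?(row_mxEl, row_mxEr) !mxE;
    case: (split_ordP j) => j' ->; rewrite !mxE /= ?ord1 ?addn0 //.
pose E : 'M[F]_(n + 1) := block_mx 1%:M 0 ((- a^-1) *: w) 1%:M.
have dE : \det E = 1 by rewrite det_lblock !det1 mulr1.
pose g := \row_(i < n) ((x i - x n) / (x i + y n)).
pose h := \row_(j < n) ((y j - y n) / (x n + y j)).
have AEE : A *m E = block_mx (diag_mx g *m B *m diag_mx h) v 0 a%:M.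
  rewrite AE mulmx_block !mulmx1 !mulmx0 !add0r; congr block_mx; last first.
    by rewrite mul_scalar_mx scalerA mulrN mulfV // scaleN1r subrr.
  apply/matrixP => i j.
  rewrite mul_mx_diag mul_diag_mx !mxE big_ord1 !mxE /a /f.
  have := xy0 _ _ (leqnn n) (leqnn n); have := xy0 i j (ltnW _) (ltnW _).
  have := xy0 n j (leqnn n) (ltnW _); have := xy0 i n (ltnW _) (leqnn n).
  move=> /(_ (ltn_ord _)) h1 /(_ (ltn_ord _)) h2 /(_ (ltn_ord _) (ltn_ord _)) h3 h4.
  by field; rewrite h1 h2 h3 h4 oner_neq0.
have := congr1 determinant AEE.
rewrite det_mulmx dE mulr1 det_ublock !det_mulmx !det_diag det_scalar1 => ->.
rewrite [_ * \det B]mulrC -!mulrA; congr (_ * _).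
rewrite mulrA -big_split /= mulrC; congr (_ * _); apply: eq_bigr => i _.
by rewrite !mxE invfM; ring.
Qed.

End CauchyDeterminant.

(** * The determinant in closed form *)

Section ClosedForm.
Variables (F : numFieldType) (b c : F).
Hypothesis b_sub_odd : forall k : nat, (2 * k + 1)%:R - b != 0.
Hypothesis b_add_odd : forall k : nat, (2 * k + 1)%:R + b != 0.

(** The matrix under study, with [b] and [c] kept abstract: its [(j, k)] entry is
    the sum of a coefficient of index [j - k] and one of index [j + k + 1], of which
    only the one of odd index survives. *)
Definition entry (j k : nat) : F :=
  c * (if odd (j + k) then j%:R - k%:R - b else (j + k + 1)%:R - b)^-1.

Definition detM n := \det (\matrix_(j < n, k < n) entry j k).

(** The two shapes of the entries become one: up to the row signs [(-1) ^+ j],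
    the matrix is the Cauchy matrix of these two sequences. *)
Definition cx j : F := (-1) ^+ j * (j%:R + 2^-1 - b).
Definition cy k : F := (-1) ^+ k * (k%:R + 2^-1).

Lemma odd_diff_neq0 i j : odd (i + j) -> (i%:R - j%:R - b : F) != 0.
Proof.
move=> o; case: (ltnP i j) => ij.
- have [k jE] : exists k, j = (i + (2 * k + 1))%N.
    by exists (j - i)./2; lia.
  rewrite jE natrD (_ : _ - _ = - ((2 * k + 1)%:R + b)) ?oppr_eq0 ?b_add_odd //; ring.
- have [k iE] : exists k, i = (j + (2 * k + 1))%N.
    by exists (i - j)./2; lia.
  rewrite iE natrD (_ : _ - _ = ((2 * k + 1)%:R - b)) ?oppr_eq0 ?b_sub_odd //; ring.
Qed.

Lemma even_sum_neq0 i j : ~~ odd (i + j) -> ((i + j + 1)%:R - b : F) != 0.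
Proof.
move=> o; rewrite (_ : (i + j)%N = (2 * (i + j)./2)%N) ?b_sub_odd //; lia.
Qed.

Lemma sgn_odd n : (-1) ^+ n = (if odd n then -1 else 1 : F).
Proof. by rewrite -signr_odd; case: odd. Qed.

Lemma half2 : (2^-1 + 2^-1 : F) = 1.
Proof. by field. Qed.

Lemma cxDy j k : cx j + cy k =
  (-1) ^+ j * (if odd (j + k) then j%:R - k%:R - b else (j + k + 1)%:R - b).
Proof.
rewrite /cx /cy !sgn_odd oddD !natrD; have := half2; set a := 2^-1 => aE.
by case: (odd j); case: (odd k) => /=; rewrite -aE; ring.
Qed.

Lemma cxDy_neq0 j k : cx j + cy k != 0.
Proof.
rewrite cxDy mulf_neq0 ?signr_eq0 //.
by case: ifPn => [/odd_diff_neq0|/even_sum_neq0].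
Qed.

Lemma entryE j k : entry j k = c * (-1) ^+ j * (cx j + cy k)^-1.
Proof.
rewrite /entry cxDy invfM -mulrA; congr (c * _).
by rewrite invr_sign mulrA -expr2 sqrr_sign mul1r.
Qed.

Lemma detME n : detM n = (\prod_(j < n) (c * (-1) ^+ j)) *
  \det (\matrix_(j < n, k < n) (cx j + cy k)^-1).
Proof.
rewrite /detM (_ : (\matrix_(j, k) entry j k) =
  diag_mx (\row_(j < n) (c * (-1) ^+ j)) *m
  (\matrix_(j < n, k < n) (cx j + cy k)^-1)).
  rewrite det_mulmx det_diag; congr (_ * _).
  by apply: eq_bigr => j _; rewrite mxE.
by apply/matrixP => j k; rewrite mul_diag_mx !mxE entryE.
Qed.

(** The contribution of the pair of indices [i < n] to the ratio of consecutive
    determinants. *)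
Definition detM_factor n i : F :=
  if odd (i + n) then (i + n + 1)%:R * ((i + n + 1)%:R - 2 * b)
                      / ((n%:R - i%:R) ^+ 2 - b ^+ 2)
  else (n%:R - i%:R) ^+ 2 / ((i + n + 1)%:R - b) ^+ 2.

Lemma detM_step n : detM n.+1 = detM n *
  (c / ((2 * n + 1)%:R - b) * \prod_(i < n) detM_factor n i).
Proof.
rewrite !detME cauchy_det_step => [|i j _ _]; last exact: cxDy_neq0.
have sg2 : ((-1) ^+ n * (-1) ^+ n : F) = 1 by rewrite -expr2 sqrr_sign.
rewrite big_ord_recr /= (cxDy n n) addnn odd_double invfM invr_sign -addnn.
rewrite (_ : (n + n + 1)%:R = (2 * n + 1)%:R); last by congr (_%:R); lia.
have facE (i : nat) : (cx i - cx n) * (cy i - cy n) / ((cx i + cy n) * (cx n + cy i))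
    = detM_factor n i.
  rewrite !cxDy /detM_factor [(n + i)%N]addnC.
  case: ifPn => o; have := half2; rewrite /cx /cy !sgn_odd; set a := 2^-1 => aE.
  - have h1 := odd_diff_neq0 o.
    have /odd_diff_neq0 h2 : odd (n + i) by rewrite addnC.
    have h3 : (n%:R - i%:R) ^+ 2 - b ^+ 2 != 0.
      rewrite subr_sqr mulf_neq0 //.
      by rewrite (_ : _ + b = - (i%:R - n%:R - b)) ?oppr_eq0 //; ring.
    move: o; rewrite oddD !natrD (_ : 1%:R = a + a) //; case: (odd i); case: (odd n) => //= _;
      by field; rewrite h1 h2 h3.
  - have h1 := even_sum_neq0 o.
    move: o h1; rewrite oddD !natrD (_ : 1%:R = a + a) //; case: (odd i); case: (odd n) => //= _ h1;
      by field; rewrite ?h1.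
rewrite [X in _ * (_ * (_ * X)) = _](eq_bigr (fun i : 'I_n => detM_factor n i)); last first.
  by move=> i _; exact: facE.
move: sg2; set s := (-1) ^+ n => sg2.
by rewrite -[RHS]mul1r -sg2; ring.
Qed.

Lemma detM_factor_eq0 n i : (i < n)%N ->
  (detM_factor n i == 0) = odd (i + n) && ((i + n + 1)%:R == 2 * b).
Proof.
move=> ltin; rewrite /detM_factor; case: ifPn => o /=.
- have h1 := odd_diff_neq0 o.
  have /odd_diff_neq0 h2 : odd (n + i) by rewrite addnC.
  have h3 : (n%:R - i%:R) ^+ 2 - b ^+ 2 != 0.
    rewrite subr_sqr mulf_neq0 //.
    by rewrite (_ : _ + b = - (i%:R - n%:R - b)) ?oppr_eq0 //; ring.
  by rewrite mulf_eq0 invr_eq0 (negbTE h3) orbF mulf_eq0 subr_eq0 pnatr_eq0 addn1.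
- apply/negbTE; rewrite mulf_neq0 ?invr_eq0 ?expf_neq0 ?even_sum_neq0 //.
  by rewrite subr_eq0 eqr_nat; lia.
Qed.

(** Only the numerators [i + n + 1 - 2 b] can vanish; they come from coinciding
    nodes of the Cauchy matrix. *)
Lemma detM_eq0 n : c != 0 ->
  (detM n == 0) = [exists p : 'I_n * 'I_n,
    [&& (p.1 < p.2)%N, odd (p.1 + p.2) & (p.1 + p.2 + 1)%:R == 2 * b]].
Proof.
move=> c0; elim: n => [|n IH].
  rewrite /detM det_mx00 oner_eq0; apply/esym/negbTE/existsPn => -[[]] //.
rewrite detM_step mulf_eq0 IH mulf_eq0 mulf_eq0 invr_eq0 (negbTE c0) /=.
rewrite (negbTE (b_sub_odd n)) /= prodf_seq_eq0.
apply/orP/existsP => [[/existsP[[i j] /= h]|/hasP[i _ /= h]]|[[i j] /= h]].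
- by exists (widen_ord (leqnSn n) i, widen_ord (leqnSn n) j).
- exists (widen_ord (leqnSn n) i, ord_max) => /=.
  by rewrite ltn_ord /= -detM_factor_eq0.
- have [jn|jn] := ltnP j n.
  + left; apply/existsP.
    have ij : (i < n)%N by case/and3P: h => /ltn_trans ->.
    by exists (Ordinal ij, Ordinal jn).
  + have jE : j = n :> nat by apply/eqP; rewrite eqn_leq jn -ltnS ltn_ord.
    right; rewrite jE in h; case/and3P: h => ij o e.
    apply/hasP; exists (Ordinal ij); first by rewrite mem_index_enum.
    by rewrite /= detM_factor_eq0 // o e.
Qed.

(** The factor that recurs in the ratio of consecutive determinants once the
    factors common with [costrunc] are removed; it is [1 + O(p^-2)]. *)
Definition hfac p : F :=
  (2 * p)%:R * ((2 * p)%:R - 2 * b) / (((2 * p)%:R - b) ^+ 2 - 1).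

(** Partial product of [2 cos (pi b / 2) / pi], written as the product of
    [1 - b^2 / (2k-1)^2] and of the Wallis factors [1 - 1 / (2k)^2]; the
    factor [2K + 1] is what the latter leave by telescoping. *)
Definition costrunc K : F :=
  (2 * K + 1)%:R *
  \prod_(k < K) (((2 * k + 1)%:R ^+ 2 - b ^+ 2) / (2 * k + 2)%:R ^+ 2).

(** The three linear factors belonging to the Barnes functions at [1 - b],
    [1/2 + b/2] and [3/2 + b/2], whose [k+1]-st powers enter their products. *)
Definition barnes3_factor k : F :=
  (1 - b / k.+1%:R) *
  ((1 + (b / 2 - 1 / 2) / k.+1%:R) * (1 + (b / 2 + 1 / 2) / k.+1%:R)).

Definition barnes3 K : F := \prod_(k < K) barnes3_factor k ^+ k.+1.

Lemma sqrB_neq0 k : (2 * k + 1)%:R ^+ 2 - b ^+ 2 != 0.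
Proof. by rewrite subr_sqr mulf_neq0. Qed.

Lemma costrunc_neq0 K : costrunc K != 0.
Proof.
rewrite mulf_neq0 ?pnatr_eq0 ?addn1 // prodf_seq_neq0; apply/allP => k _ /=.
by rewrite mulf_neq0 ?sqrB_neq0 // invr_eq0 expf_neq0 // pnatr_eq0 addn2.
Qed.

Lemma costruncS K : costrunc K.+1 = costrunc K * ((2 * K + 3)%:R / (2 * K + 1)%:R *
  (((2 * K + 1)%:R ^+ 2 - b ^+ 2) / (2 * K + 2)%:R ^+ 2)).
Proof.
rewrite /costrunc big_ord_recr /= (_ : (2 * K.+1 + 1 = 2 * K + 3)%N); last by lia.
have h : (2 * K + 1)%:R != 0 :> F by rewrite pnatr_eq0 addn1.
have h2 : (2 * K + 2)%:R != 0 :> F by rewrite pnatr_eq0 addn2.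
by move: h h2; move: (2 * K + 1)%:R (2 * K + 2)%:R (2 * K + 3)%:R => A B C h h2; field; rewrite h h2.
Qed.

(** [detM_factor n i] indexed from the other end, by [t = n - 1 - i], so that its
    shape depends on the parity of [t] only and not on that of [n]. *)
Let gfac n t : F :=
  if odd t then t.+1%:R ^+ 2 / ((2 * n - t)%:R - b) ^+ 2
  else (2 * n - t)%:R * ((2 * n - t)%:R - 2 * b) / (t.+1%:R ^+ 2 - b ^+ 2).

Lemma detM_factor_rev n :
  \prod_(i < n) detM_factor n i = \prod_(t < n) gfac n t.
Proof.
rewrite (reindex_inj rev_ord_inj); apply: eq_bigr => t _ /=.
have tn := ltn_ord t; rewrite /detM_factor /gfac.
rewrite (_ : odd (n - t.+1 + n) = ~~ odd t); last by lia.
rewrite (_ : (n - t.+1 + n + 1)%N = (2 * n - t)%N); last by lia.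
rewrite [(n - t.+1)%:R]natrB // (_ : n%:R - (n%:R - t.+1%:R) = t.+1%:R); last by ring.
by case: odd.
Qed.

(** Factors are taken in consecutive pairs: the denominators [(2p - 1 - b)^2] of
    the odd ones telescope into the [(2p - 1 - b) (2p + 1 - b)] of [hfac], leaving
    one boundary quotient. *)
Lemma gfac_prod n K : (2 * K <= n)%N ->
  \prod_(t < 2 * K) gfac n t = (2 * K + 1)%:R / costrunc K *
   \prod_((n - K).+1 <= p < n.+1) hfac p *
   (((2 * n + 1)%:R - b) / ((2 * (n - K) + 1)%:R - b)).
Proof.
elim: K => [_|K IH Kn].
  rewrite big_ord0 big_geq ?subn0 // /costrunc big_ord0 !mulr1 divff ?mulf_neq0 //.
  by rewrite mul1r divff.
rewrite (_ : (2 * K.+1 = (2 * K).+2)%N); last by lia.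
rewrite !big_ord_recr IH /=; last by lia.
rewrite [in RHS]big_ltn; last by lia.
rewrite (_ : (n - K.+1).+1 = (n - K)%N); last by lia.
rewrite costruncS.
have -> : gfac n (2 * K) = (2 * (n - K))%:R * ((2 * (n - K))%:R - 2 * b) /
    ((2 * K + 1)%:R ^+ 2 - b ^+ 2).
  by rewrite /gfac oddM /= -mulnBr addn1.
have -> : gfac n (2 * K).+1 = (2 * K + 2)%:R ^+ 2 / ((2 * (n - K))%:R - 1 - b) ^+ 2.
  rewrite /gfac /= oddM /= addn2 (_ : (2 * n - (2 * K).+1)%N = (2 * (n - K) - 1)%N); last by lia.
  by rewrite natrB //; lia.
rewrite /hfac (_ : (2 * (n - K.+1) + 1)%N = (2 * (n - K) - 1)%N); last by lia.
rewrite [(2 * (n - K) - 1)%:R]natrB; last by lia.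
have h1 : (2 * (n - K))%:R - 1 - b != 0.
  rewrite (_ : _ - 1 = (2 * (n - K) - 1)%:R); last by rewrite natrB //; lia.
  by rewrite (_ : (2 * (n - K) - 1 = 2 * (n - K.+1) + 1)%N) ?b_sub_odd //; lia.
have h2 : (2 * (n - K))%:R + 1 - b != 0 by rewrite natr1 -addn1 b_sub_odd.
have h3 := sqrB_neq0 K; have h4 := costrunc_neq0 K.
have h5 : (2 * K + 1)%:R != 0 :> F by rewrite pnatr_eq0 addn1.
have h6 : (2 * K + 2)%:R != 0 :> F by rewrite pnatr_eq0 addn2.
have h7 : (2 * K + 3)%:R != 0 :> F by rewrite pnatr_eq0 addn3.
have h8 : ((2 * (n - K))%:R - b) ^+ 2 - 1 != 0.
  rewrite (_ : _ - 1 = ((2 * (n - K))%:R - 1 - b) * ((2 * (n - K))%:R + 1 - b)).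
    by rewrite mulf_neq0.
  by ring.
rewrite [(2 * (n - K) + 1)%:R]natrD (_ : ((2 * K).+2 + 1 = 2 * K + 3)%N); last by lia.
move: h1 h2 h3 h4 h5 h6 h7 h8; move: (costrunc K) (\prod_(_ <= _ < _) _).
move: (2 * (n - K))%:R (2 * K + 1)%:R (2 * K + 2)%:R (2 * K + 3)%:R.
move=> X A B C D P h1 h2 h3 h4 h5 h6 h7 h8.
by field; rewrite h1 h2 h3 h4 h5 h6 h7 h8.
Qed.

Lemma detM_step_even K : detM (2 * K).+1 = detM (2 * K) *
  (c / costrunc K * ((2 * K + 1)%:R / ((2 * K + 1)%:R - b)) *
   \prod_(K.+1 <= p < (2 * K).+1) hfac p).
Proof.
rewrite detM_step detM_factor_rev gfac_prod // (_ : (2 * K - K = K)%N); last by lia.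
congr (_ * _); have h1 := b_sub_odd K; have := b_sub_odd (2 * K); have := costrunc_neq0 K.
move: h1; move: (costrunc K) (2 * K + 1)%:R (2 * (2 * K) + 1)%:R => A B C h1 h2 h3.
by field; rewrite h1 h2 h3.
Qed.

Lemma detM_step_odd K : detM (2 * K).+2 = detM (2 * K).+1 *
  (c / costrunc K * ((2 * K + 1)%:R / ((2 * K + 1)%:R + b)) *
   \prod_(K.+1 <= p < (2 * K).+2) hfac p).
Proof.
rewrite detM_step detM_factor_rev big_ord_recr /= gfac_prod //.
rewrite (_ : ((2 * K).+1 - K = K.+1)%N); last by lia.
rewrite [in RHS]big_ltn; last by lia.
rewrite /gfac oddM /= /hfac.
rewrite (_ : (2 * (2 * K).+1 - 2 * K = 2 * K.+1)%N); last by lia.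
rewrite (_ : ((2 * K.+1)%:R = (2 * K + 1)%:R + 1)); last first.
  by rewrite natr1; congr _%:R; lia.
rewrite (_ : ((2 * K.+1 + 1)%:R = (2 * K + 1)%:R + 2)); last first.
  by rewrite -natrD; congr _%:R; lia.
rewrite -[(2 * K).+1]addn1.
congr (_ * _); have h1 := b_sub_odd K; have h2 := b_add_odd K; have h3 := b_sub_odd (2 * K + 1).
have h4 := b_sub_odd K.+1; have h5 := costrunc_neq0 K.
rewrite (_ : (2 * K.+1 + 1)%:R = (2 * K + 1)%:R + 2) in h4; last first.
  by rewrite -natrD; congr _%:R; lia.
move: h1 h2 h3 h4 h5; move: (costrunc K) (2 * K + 1)%:R (2 * (2 * K + 1) + 1)%:R (\prod_(_ <= _ < _) _).
move=> A B C P h1 h2 h3 h4 h5.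
have h6 : B ^+ 2 - b ^+ 2 != 0 by rewrite subr_sqr mulf_neq0.
have h7 : (B + 1 - b) ^+ 2 - 1 != 0.
  by rewrite (_ : _ - 1 = (B - b) * (B + 2 - b)) ?mulf_neq0 //; ring.
by field; rewrite h2 h3 h4 h5 h6 h7.
Qed.

(** Used with [K = n./2] only, but the induction step changes [K] and [n]
    separately. *)
Definition closedM K n : F := barnes3 K * (c / costrunc K) ^+ n *
  ((2 * K + 1)%:R / ((2 * K + 1)%:R + b)) ^+ K *
  ((2 * K + 1)%:R / ((2 * K + 1)%:R - b)) ^+ (n - K) *
  \prod_(K.+1 <= p < n) hfac p ^+ (n - p).

Lemma prod_hfac_recr m n : (m <= n)%N ->
  \prod_(m <= p < n.+1) hfac p ^+ (n.+1 - p) =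
  (\prod_(m <= p < n) hfac p ^+ (n - p)) * \prod_(m <= p < n.+1) hfac p.
Proof.
move=> mn; rewrite [X in X * _](_ : _ = \prod_(m <= p < n.+1) hfac p ^+ (n - p)).
  rewrite -big_split /= !big_nat; apply: eq_bigr => p /andP[_ pn].
  by rewrite subSn // exprSr.
by rewrite big_nat_recr //= subnn expr0 mulr1.
Qed.

Lemma closedM_even K : closedM K (2 * K).+1 = closedM K (2 * K) *
  (c / costrunc K * ((2 * K + 1)%:R / ((2 * K + 1)%:R - b)) *
   \prod_(K.+1 <= p < (2 * K).+1) hfac p).
Proof.
rewrite /closedM; case: K => [|K].
  by rewrite !big_geq //= !expr0 !expr1; ring.
rewrite prod_hfac_recr; last by lia.
rewrite subSn; last by lia.
rewrite [(c / _) ^+ (2 * K.+1).+1]exprS [(_ / (_ - b)) ^+ (2 * K.+1 - K.+1).+1]exprS.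
move: (barnes3 _) ((c / _) ^+ _) (_ ^+ K.+1) (_ ^+ (_ - _)) => A1 A2 A3 A4.
move: (_ / (_ - b)) (c / _) (\prod_(_ <= _ < _) _) (\prod_(_ <= _ < _) _) => A5 A6 A7 A8.
by ring.
Qed.

(** Here [K] increases, and all factors carrying the exponent [K + 1] combine into
    one power; the identity between the bases is a rational one. *)
Lemma closedM_odd K : closedM K.+1 (2 * K).+2 = closedM K (2 * K).+1 *
  (c / costrunc K * ((2 * K + 1)%:R / ((2 * K + 1)%:R + b)) *
   \prod_(K.+1 <= p < (2 * K).+2) hfac p).
Proof.
have base : barnes3_factor K * (c / costrunc K.+1) ^+ 2 *
    ((2 * K + 3)%:R / ((2 * K + 3)%:R + b)) * ((2 * K + 3)%:R / ((2 * K + 3)%:R - b)) =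
    (c / costrunc K) ^+ 2 * ((2 * K + 1)%:R / ((2 * K + 1)%:R + b)) *
    ((2 * K + 1)%:R / ((2 * K + 1)%:R - b)) * hfac K.+1.
  rewrite costruncS /barnes3_factor /hfac.
  have h1 := b_sub_odd K; have h2 := b_add_odd K; have h3 := costrunc_neq0 K.
  have h4 := b_sub_odd K.+1; have h5 := b_add_odd K.+1.
  have h6 : K.+1%:R != 0 :> F by rewrite pnatr_eq0.
  have h7 : (2 * K + 1)%:R != 0 :> F by rewrite pnatr_eq0 addn1.
  have h8 : (2 * K + 3)%:R != 0 :> F by rewrite pnatr_eq0 addn3.
  have e1 : (2 * K + 1)%:R = 2 * K.+1%:R - 1 :> F by rewrite -natr1; ring.
  have e2 : (2 * K + 2)%:R = 2 * K.+1%:R :> F by rewrite -natr1; ring.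
  have e3 : (2 * K + 3)%:R = 2 * K.+1%:R + 1 :> F by rewrite -natr1; ring.
  have e4 : (2 * K.+1)%:R = 2 * K.+1%:R :> F by rewrite natrM.
  have e5 : (2 * K.+1 + 1)%:R = 2 * K.+1%:R + 1 :> F by rewrite natrD natrM.
  rewrite e1 e2 e3 e4 ?e5 in h1 h2 h4 h5 h7 h8 *.
  move: h1 h2 h3 h4 h5 h6 h7 h8; move: (costrunc K) (K.+1%:R) => A B h1 h2 h3 h4 h5 h6 h7 h8.
  have h9 : (2 * B - b) ^+ 2 - 1 != 0.
    by rewrite (_ : _ - 1 = (2 * B - 1 - b) * (2 * B + 1 - b)) ?mulf_neq0 //; ring.
  have h10 : (2 * B - 1) ^+ 2 - b ^+ 2 != 0 by rewrite subr_sqr mulf_neq0.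
  by field; rewrite h1 h2 h3 h4 h5 h6 h7 h8 h9 h10.
rewrite /closedM.
rewrite [X in _ = X](_ : _ = barnes3 K *
    ((c / costrunc K) ^+ (2 * K).+1 * (c / costrunc K)) *
    (((2 * K + 1)%:R / ((2 * K + 1)%:R + b)) ^+ K * ((2 * K + 1)%:R / ((2 * K + 1)%:R + b)))
    * ((2 * K + 1)%:R / ((2 * K + 1)%:R - b)) ^+ ((2 * K).+1 - K) *
    ((\prod_(K.+1 <= p < (2 * K).+1) hfac p ^+ ((2 * K).+1 - p)) *
     \prod_(K.+1 <= p < (2 * K).+2) hfac p)); last by ring.
rewrite -prod_hfac_recr; last by lia.
rewrite -!exprSr [in RHS]big_ltn; last by lia.
rewrite (_ : ((2 * K).+2 - K.+1 = K.+1)%N); last by lia.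
rewrite (_ : ((2 * K).+1 - K = K.+1)%N); last by lia.
rewrite (_ : ((2 * K).+2 = 2 * K.+1)%N) ?[_ ^+ (2 * _)]exprM; last by lia.
rewrite /barnes3 big_ord_recr /= (_ : (2 * K.+1 + 1 = 2 * K + 3)%N); last by lia.
move: base; move: (barnes3_factor K) (c / costrunc K.+1) (_ / (_ + b)) (_ / (_ - b)) => x y z w.
move: (c / costrunc K) (_ / (_ + b)) (_ / (_ - b)) (hfac K.+1) => x' y' z' w' base.
move: (\prod_(i < K) _) (\prod_(_ <= _ < _) _) => P Q.
transitivity (P * (x * y ^+ 2 * z * w) ^+ K.+1 * Q).
  by rewrite !exprMn !mulrA.
by rewrite base !exprMn !mulrA.
Qed.

(** The leading behaviour of [detM n] is carried by [barnes3 n./2], a truncation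
    of the product of three Barnes functions; all remaining factors are close
    to [1], up to exponents of size [n]. *)
Theorem detM_closed n : detM n = closedM n./2 n.
Proof.
have key K : detM (2 * K) = closedM K (2 * K) /\
             detM (2 * K).+1 = closedM K (2 * K).+1.
  elim: K => [|K [_ IH]].
    have e0 : detM (2 * 0) = closedM 0 (2 * 0).
      by rewrite /detM det_mx00 /closedM big_geq // /barnes3 big_ord0 !expr0 !mulr1.
    by split=> //; rewrite detM_step_even closedM_even e0.
  have e : detM (2 * K.+1) = closedM K.+1 (2 * K.+1).
    rewrite (_ : (2 * K.+1 = (2 * K).+2)%N); last by lia.
    by rewrite detM_step_odd IH closedM_odd.
  by split=> //; rewrite detM_step_even closedM_even e.
have [k0 k1] := key n./2.
have := odd_double_half n; case: (odd n) => /= e.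
  by rewrite -[n in detM n]e -[n in closedM _ n]e -mul2n.
by rewrite -[n in detM n]e -[n in closedM _ n]e -mul2n.
Qed.

End ClosedForm.

(** * Products of factors close to one *)

Section NearOne.
Variable R : realType.
Implicit Types (z w u v : R[i]) (x y : R).

(** Being close to [1] in a form stable under products: the bounds [x] add up. *)
Definition near1 z x := normc (z - 1) <= expR x - 1.

Lemma near1_mul z w x y : near1 z x -> near1 w y -> near1 (z * w) (x + y).
Proof.
rewrite /near1 expRD => hz hw.
rewrite (_ : z * w - 1 = (z - 1) * (w - 1) + ((z - 1) + (w - 1))); last by ring.
apply: le_trans (normcD_le _ _) _; rewrite normcM.
have h1 := normcD_le (z - 1) (w - 1).
have h2 := ler_pM (normc_ge0 _) (normc_ge0 _) hz hw.
lra.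
Qed.

Lemma near1_pow u n : near1 ((1 + u) ^+ n) (n%:R * normc u).
Proof.
elim: n => [|n IH]; first by rewrite /near1 expr0 mul0r expR0 !subrr normc0.
rewrite exprSr -natr1 mulrDl mul1r; apply: near1_mul => //.
rewrite /near1 addrAC subrr add0r lerBrDr addrC; exact: expR_ge1Dx.
Qed.

Lemma near1_prod (I : Type) (r : seq I) (P : pred I) (u : I -> R[i]) (n : I -> nat) :
  near1 (\prod_(i <- r | P i) (1 + u i) ^+ n i)
        (\sum_(i <- r | P i) (n i)%:R * normc (u i)).
Proof.
apply: (big_ind2 (fun z x => near1 z x)); last by move=> i _; exact: near1_pow.
  by rewrite /near1 expR0 !subrr normc0.
by move=> *; exact: near1_mul.
Qed.

Lemma near1_le z x y : near1 z x -> x <= y -> near1 z y.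
Proof.
by rewrite /near1 => h xy; apply: le_trans h _; rewrite lerD2r ler_expR.
Qed.

Lemma expR_sub1_cvg0 (d : nat -> R) : d n @[n --> \oo] --> (0 : R) ->
  expR (d n) - 1 @[n --> \oo] --> (0 : R).
Proof.
move=> d0; rewrite -(subrr (1 : R)) -{2}(@expR0 R); apply: cvgB; last exact: cvg_cst.
by apply: (continuous_cvg _ _ d0); exact: continuous_expR.
Qed.

Lemma near1_cvg (u : nat -> R[i]^o) (d : nat -> R) :
  (\forall n \near \oo, near1 (u n) (d n)) -> d n @[n --> \oo] --> (0 : R) ->
  u n @[n --> \oo] --> (1 : R[i]^o).
Proof.
move=> h d0; apply: (normc_cvg_le h).
exact: expR_sub1_cvg0.
Qed.

(** The bounds are uniform in the length of the product, so they survive the passage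
    to an infinite product. *)
Lemma near1_lim (u : nat -> R[i]^o) (l : R[i]^o) x :
  u n @[n --> \oo] --> l -> (\forall n \near \oo, near1 (u n) x) -> near1 l x.
Proof.
move=> ul hx; rewrite /near1 leNgt; apply/negP => lt.
have d0 : 0 < normc (l - 1) - (expR x - 1) by rewrite subr_gt0.
have /cvgrPdist_lt hd : normc (u n - l) @[n --> \oo] --> (0 : R) by exact: normc_cvg0.
have [n []] := filter_ex (filterI (hd _ d0) hx).
rewrite /= sub0r normrN ger0_norm ?normc_ge0 // => h1 h2; move: h1 h2.
rewrite /near1 -(normcN1 (u n - l)) opprB => h1 h2.
have := normcB_ge (l - 1) (u n - 1).
by rewrite (_ : l - 1 - (u n - 1) = l - u n); [lra|ring].
Qed.

(** Along the segment [t |-> (1 + t u) exp (- t v)] from [1], the derivative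
    is [(u - v - t u v) exp (- t v)]. *)
Lemma exp_approx u v : normc v <= 1 ->
  normc ((1 + u) * cexp (- v) - 1) <=
  2 * expR 1 * (normc (u - v) + normc u * normc v).
Proof.
move=> v1.
pose Q (t : R) := (1 + u * t%:C) * cexp ((- v) * t%:C).
pose Q' (t : R) := (u - v - u * v * t%:C) * cexp ((- v) * t%:C).
have dQ t : isD Q t (Q' t).
  apply: isD_eq.
    apply: isD_mul.
      by apply: isD_add; [exact: isD_cst|apply: isD_scale; exact: isD_id].
    by apply: isD_cexp; apply: isD_scale; exact: isD_id.
  by rewrite /Q'; ring.
have := @isD_mean_value R Q Q' 0 1 (expR 1 * (normc (u - v) + normc u * normc v)) ler01 dQ.
rewrite /Q !mulr1 mulr0 addr0 mulr0 cexp0 subr0 !mulr1 mulrA; apply.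
move=> t /andP[t0 t1]; rewrite /Q' normcM mulrC; apply: ler_pM => //; rewrite ?normc_ge0 //.
- apply: le_trans (normc_cexp_le _) _; rewrite ler_expR normcM normcN1 normc_real.
  by rewrite ger0_norm // mulr_ile1 // normc_ge0.
- apply: le_trans (normcB_le _ _) _; rewrite lerD2l !normcM normc_real ger0_norm //.
  by rewrite ler_piMr // mulr_ge0 // normc_ge0.
Qed.

(** The same argument one order further: the derivative of
    [t |-> (1 + t u) exp (- t u + (t u)^2 / 2)] is [t^2 u^3] times the
    exponential. *)
Lemma exp_approx3 u : normc u <= 1 ->
  normc ((1 + u) * cexp (- u + u ^+ 2 / 2) - 1) <= 2 * expR 2 * normc u ^+ 3.
Proof.
move=> u1.
pose E (t : R) := cexp ((- u) * t%:C + (u ^+ 2 / 2) * (t%:C * t%:C)).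
pose Q (t : R) := (1 + u * t%:C) * E t.
pose Q' (t : R) := u ^+ 3 * (t%:C * t%:C) * E t.
have dQ t : isD Q t (Q' t).
  apply: isD_eq.
    apply: isD_mul.
      by apply: isD_add; [exact: isD_cst|apply: isD_scale; exact: isD_id].
    apply: isD_cexp; apply: isD_add; apply: isD_scale; first exact: isD_id.
    by apply: isD_mul; exact: isD_id.
  by rewrite /Q' /E; field.
have := @isD_mean_value R Q Q' 0 1 (expR 2 * normc u ^+ 3) ler01 dQ.
rewrite /Q /E !mulr1 !mulr0 !addr0 cexp0 subr0 !mulr1 mulrA; apply.
move=> t /andP[t0 t1]; rewrite /Q' normcM mulrC; apply: ler_pM => //; rewrite ?normc_ge0 //.
- rewrite /E; apply: le_trans (normc_cexp_le _) _; rewrite ler_expR.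
  apply: le_trans (normcD_le _ _) _.
  rewrite !normcM normcN1 normcV normc_nat normc_real ger0_norm //.
  have s0 : 0 <= normc u * t by rewrite mulr_ge0 // normc_ge0.
  have s1 : normc u * t <= 1 by rewrite mulr_ile1 // normc_ge0.
  by move: s0 s1; rewrite (_ : _ / 2 * _ = (normc u * t) * (normc u * t) / 2); [nra|field].
- rewrite normcM normcX normcM normc_real ger0_norm //.
  by rewrite ler_piMr ?exprn_ge0 ?normc_ge0 // mulr_ile1.
Qed.

(** The bound on the deviations is summed through
    [1 / (k+1)^2 <= 1 / k - 1 / (k+1)]. *)
Lemma prod_tail (e : nat -> R[i]) (w : nat -> nat) (N : nat) (M : R) :
  0 <= M ->
  (forall k, (N <= k)%N -> (w k)%:R * normc (e k) <= M / k.+1%:R ^+ 2) ->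
  forall n m, (N <= n)%N -> (0 < n)%N -> (n <= m)%N ->
  near1 (\prod_(n <= k < m) (1 + e k) ^+ w k) (M / n%:R).
Proof.
move=> M0 h n m Nn n0 nm; apply: near1_le (near1_prod _ _ _ _) _.
have key : \sum_(n <= k < m) (M / k.+1%:R ^+ 2) <= M / n%:R - M / m%:R.
  elim: m nm => [|m IH]; first by rewrite leqn0 => /eqP ->; rewrite big_geq // subrr.
  rewrite leq_eqVlt => /predU1P[<-|nm]; first by rewrite big_geq // subrr.
  rewrite big_nat_recr //=; apply: le_trans (lerD (IH nm) (lexx _)) _.
  rewrite -subr_ge0 (_ : _ - _ = M * (m%:R^-1 - m.+1%:R^-1 - (m.+1%:R ^+ 2)^-1)).
    rewrite mulr_ge0 // -natr1.
    have m0 : 0 < (m%:R : R) by rewrite ltr0n; rewrite ltnS in nm; exact: leq_trans nm.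
    have m1 : 0 < (m%:R + 1 : R) by rewrite ltr_wpDr.
    rewrite (_ : _ - _ = (m%:R * (m%:R + 1) ^+ 2)^-1).
      by rewrite invr_ge0 mulr_ge0 ?exprn_ge0 // ltW.
    by field; rewrite !gt_eqF.
  by ring.
apply: le_trans (ler_sum_nat _) _; last first.
  apply: le_trans key _; rewrite lerBlDr lerDl divr_ge0 //.
by move=> k /andP[nk _]; apply: h; exact: leq_trans nk.
Qed.

(** The limit is exhibited as a truncated product times a correction [r n] tending
    to [1].  This form is meaningful also when some factor, hence the limit,
    is zero. *)
Lemma prod_cvg (e : nat -> R[i]) (w : nat -> nat) (N : nat) (M : R) :
  0 <= M ->
  (forall k, (N <= k)%N -> (w k)%:R * normc (e k) <= M / k.+1%:R ^+ 2) ->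
  exists2 r : nat -> R[i],
    (forall n, (N < n)%N ->
      (\prod_(0 <= k < m) (1 + e k) ^+ w k : R[i]^o) @[m --> \oo] -->
      (\prod_(0 <= k < n) (1 + e k) ^+ w k * r n : R[i]^o)) &
    (r n : R[i]^o) @[n --> \oo] --> (1 : R[i]^o).
Proof.
move=> M0 h; pose t n m := \prod_(n <= k < m) (1 + e k) ^+ w k.
have tail := prod_tail M0 h; rewrite -/(t _ _) in tail.
have Mn0 : (fun n : nat => M / n%:R) @ \oo --> (0 : R).
  rewrite -(mulr0 M); apply: cvgM; first exact: cvg_cst.
  rewrite -(cvg_shiftS (fun n => (n%:R : R)^-1)); exact: cvg_harmonic.
have en0 : (fun n : nat => expR (M / n%:R) - 1) @ \oo --> (0 : R).
  exact: expR_sub1_cvg0.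
have tcat n m p : (n <= m)%N -> (m <= p)%N -> t n p = t n m * t m p.
  by move=> nm mp; rewrite /t (big_cat_nat nm mp).
have tlim n : (N < n)%N -> exists l : R[i]^o, t n m @[m --> \oo] --> l.
  move=> Nn; pose L := expR (M / n%:R).
  have bnd m : (n <= m)%N -> normc (t n m) <= L.
    move=> nm; rewrite -(subrK 1 (t n m)); apply: (le_trans (normcD_le _ _)).
    rewrite normc1 -lerBrDr.
    exact: (tail n m (ltnW Nn) (leq_ltn_trans (leq0n _) Nn) nm).
  apply: (@cvgC_cauchy _ _ (fun m => L * (expR (M / m%:R) - 1)) n).
    move=> m p nm mp; rewrite (tcat _ _ _ nm mp) -[X in _ - X]mulr1 -mulrBr normcM.
    apply: ler_pM; rewrite ?normc_ge0 ?bnd //.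
    apply: (tail m p _ _ mp); first by apply: leq_trans nm; exact: ltnW.
    by apply: leq_trans nm; exact: leq_ltn_trans Nn.
  by rewrite -(mulr0 L); apply: cvgM => //; exact: cvg_cst.
pose r n := if pselect (exists l : R[i]^o, t n m @[m --> \oo] --> l) is left h
  then projT1 (cid h) else 0.
have rP n : (N < n)%N -> (t n m : R[i]^o) @[m --> \oo] --> (r n : R[i]^o).
  move=> Nn; rewrite /r; case: pselect => [l|/(_ (tlim n Nn)) //].
  exact: (projT2 (cid l)).
exists r.
  move=> n Nn; rewrite -(cvg_shiftn n).
  rewrite (_ : (fun m => _) = (fun m => t 0 n * t n (m + n)%N)); last first.
    by apply/funext => m; rewrite -tcat // leq_addl.
  apply: cvgM; first exact: cvg_cst.
  by rewrite (cvg_shiftn n (t n : nat -> R[i]^o)); exact: rP.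
apply: (normc_cvg_le _ en0); exists N.+1 => // n /= Nn.
have : \forall m \near \oo, near1 (t n m) (M / n%:R).
  by exists n => // m /= nm; apply: tail => //; [exact: ltnW|exact: leq_ltn_trans Nn].
exact: near1_lim (rP n Nn).
Qed.

End NearOne.

(** * The Barnes function as a limit of truncated products *)

Section Barnes.
Variable R : realType.
Implicit Types (z b : R[i]).

Definition Hn (n : nat) : R := \sum_(0 <= k < n) (k.+1%:R : R)^-1.

Lemma barnes_factor z k :
  (1 + z / k.+1%:R) ^+ k.+1 * cexp (- z + z ^+ 2 / (2 * k.+1%:R)) =
  ((1 + z / k.+1%:R) * cexp (- (z / k.+1%:R) + (z / k.+1%:R) ^+ 2 / 2)) ^+ k.+1.
Proof.
rewrite exprMn -cexp_natM; congr (_ * cexp _).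
by field; rewrite addrC natr1 pnatr_eq0.
Qed.

(** The partial product of the Barnes function, with its exponential factors
    collected into a single one. *)
Definition barnes_trunc z n : R[i] :=
  (\prod_(0 <= k < n) (1 + z / k.+1%:R) ^+ k.+1) *
  cexp (- (n%:R * z) + z ^+ 2 / 2 * (Hn n)%:C).

Lemma barnes_truncE z n : barnes_trunc z n =
  \prod_(0 <= k < n) ((1 + z / k.+1%:R) ^+ k.+1 * cexp (- z + z ^+ 2 / (2 * k.+1%:R))).
Proof.
rewrite big_split /= -cexp_sum; congr (_ * cexp _).
rewrite big_split /= big_const_nat subn0 iter_addr_0 mulr_natl mulNrn; congr (_ + _).
rewrite /Hn rmorph_sum mulr_sumr /=; apply: eq_bigr => k _.
by rewrite invfM mulrA fmorphV rmorph_nat.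
Qed.

Lemma limC_eq (u : nat -> R[i]^o) (l : R[i]^o) : u n @[n --> \oo] --> l -> limn u = l.
Proof. by move=> h; apply: cvg_lim. Qed.

(** Each factor is the [k]-th power of
    [(1 + z/k) exp (- z/k + (z/k)^2 / 2) = 1 + O(k^-3)], hence [1 + O(k^-2)]. *)
Lemma barnes_prod_trunc z :
  exists2 r : nat -> R[i]^o, r n @[n --> \oo] --> (1 : R[i]^o) &
    \forall n \near \oo, barnes_prod z = barnes_trunc z n * r n.
Proof.
pose e k := (1 + z / k.+1%:R) * cexp (- (z / k.+1%:R) + (z / k.+1%:R) ^+ 2 / 2) - 1.
pose B := normc z; pose M := 2 * expR 2 * B ^+ 3.
have B0 : 0 <= B := normc_ge0 z.
have M0 : 0 <= M by rewrite !mulr_ge0 ?expR_ge0 ?exprn_ge0.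
have [N hN] : exists N : nat, B <= N%:R.
  exists (Num.truncn B).+1; exact: ltW (Num.Theory.truncnS_gt B).
have h k : (N <= k)%N -> k.+1%:R * normc (e k) <= M / k.+1%:R ^+ 2.
  move=> Nk; have k0 : 0 < (k.+1%:R : R) by rewrite ltr0n.
  have zk : normc (z / k.+1%:R) = B / k.+1%:R by rewrite normcM normcV normc_nat.
  have zk1 : normc (z / k.+1%:R) <= 1.
    rewrite zk ler_pdivrMr // mul1r; apply: le_trans hN _.
    by rewrite ler_nat; exact: leqW.
  have := exp_approx3 zk1; rewrite -/(e k) zk => he.
  apply: le_trans (ler_wpM2l (ltW k0) he) _.
  by rewrite le_eqVlt; apply/orP; left; apply/eqP; rewrite /M; field; rewrite gt_eqF // natr1.
have [r hr r1] := prod_cvg M0 h.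
exists r => //; exists N.+1 => // n /= Nn.
have := hr n Nn; rewrite barnes_truncE.
have eE m : \prod_(0 <= k < m) (1 + e k) ^+ k.+1 = \prod_(0 <= k < m)
    ((1 + z / k.+1%:R) ^+ k.+1 * cexp (- z + z ^+ 2 / (2 * k.+1%:R))).
  by apply: eq_bigr => k _; rewrite barnes_factor /e addrC subrK.
rewrite eE (_ : (fun m => \prod_(0 <= k < m) _) = (fun m => \prod_(1 <= k < m.+1)
    ((1 + z / k%:R) ^+ k * cexp (- z + z ^+ 2 / (2 * k%:R))))).
  by move=> hz; exact: limC_eq hz.
by apply/funext => m; rewrite eE big_add1.
Qed.

Lemma barnesG1pE z : barnesG1p z =
  cexp (z / 2 * (ln (2 * pi))%:C + (- ((z + 1) * z / 2) -
    (euler_gamma R)%:C * z ^+ 2 / 2)) * barnes_prod z.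
Proof. by rewrite cexpD. Qed.

(** The arguments [1 - 2 beta], [1/2 + beta] and [3/2 + beta] correspond to
    parameters [z] of sum [0], so that the powers of [2 pi] and the exponentials
    [exp (- n z)] cancel between the three factors. *)
Lemma three_barnes (beta : R[i]) :
  exists2 r : nat -> R[i]^o, r n @[n --> \oo] --> (1 : R[i]^o) &
    \forall n \near \oo,
      barnesG (1 - 2 * beta) * barnesG (1 / 2 + beta) * barnesG (3 / 2 + beta) =
      barnes3 (2 * beta) n *
      cexp ((3 * beta ^+ 2 + 1 / 4) * (Hn n - euler_gamma R - 1)%:C) * r n.
Proof.
have [r1 r1l h1] := barnes_prod_trunc (1 - 2 * beta - 1).
have [r2 r2l h2] := barnes_prod_trunc (1 / 2 + beta - 1).
have [r3 r3l h3] := barnes_prod_trunc (3 / 2 + beta - 1).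
exists (fun n => r1 n * r2 n * r3 n).
  have -> : (1 : R[i]^o) = 1 * 1 * 1 by rewrite !mulr1.
  by apply: cvgM r3l; exact: cvgM r1l r2l.
apply: filterS3 h1 h2 h3 => n e1 e2 e3.
rewrite /barnesG !barnesG1pE e1 e2 e3 /barnes_trunc.
have -> : barnes3 (2 * beta) n =
  (\prod_(0 <= k < n) (1 + (1 - 2 * beta - 1) / k.+1%:R) ^+ k.+1) *
  (\prod_(0 <= k < n) (1 + (1 / 2 + beta - 1) / k.+1%:R) ^+ k.+1) *
  (\prod_(0 <= k < n) (1 + (3 / 2 + beta - 1) / k.+1%:R) ^+ k.+1).
  rewrite -!big_split /= /barnes3 -(big_mkord xpredT (fun k => barnes3_factor (2 * beta) k ^+ k.+1)).
  apply: eq_bigr => k _; rewrite -!exprMn; congr (_ ^+ _).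
  by rewrite /barnes3_factor; field; rewrite addrC natr1 pnatr_eq0.
set P1 := \prod_(0 <= k < n) _; set P2 := \prod_(0 <= k < n) _; set P3 := \prod_(0 <= k < n) _.
set A1 := (X in cexp X * (P1 * _ * _)); set B1 := (X in P1 * cexp X).
set A2 := (X in cexp X * (P2 * _ * _)); set B2 := (X in P2 * cexp X).
set A3 := (X in cexp X * (P3 * _ * _)); set B3 := (X in P3 * cexp X).
transitivity (P1 * P2 * P3 * cexp (A1 + B1 + A2 + B2 + A3 + B3) * (r1 n * r2 n * r3 n)).
  by rewrite !cexpD; ring.
congr (_ * cexp _ * _); rewrite /A1 /B1 /A2 /B2 /A3 /B3 !rmorphB rmorph1.
by field.
Qed.

End Barnes.

(** * Real sequences *)

Lemma cvg_near_eq (T : topologicalType) (u v : nat -> T) (l : T) :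
  (\forall n \near \oo, u n = v n) -> v n @[n --> \oo] --> l -> u n @[n --> \oo] --> l.
Proof.
move=> uv vl; apply: cvg_trans vl; apply: near_eq_cvg.
by apply: filterS uv => n ->.
Qed.

Section RealSequences.
Variable R : realType.

Lemma cvg_inv_half : ((n./2.+1)%:R : R)^-1 @[n --> \oo] --> (0 : R).
Proof.
apply: (@squeeze_cvgr _ _ _ _ (fun=> 0) (fun n => 2 * (n.+1%:R)^-1)); last 2 first.
- exact: cvg_cst.
- by rewrite -(mulr0 (2 : R)); apply: cvgM; [exact: cvg_cst|exact: cvg_harmonic].
apply: nearW => n; rewrite invr_ge0 ler0n /=.
rewrite -[leLHS]mul1r ler_pdivrMr ?ltr0n // mulrAC ler_pdivlMr ?ltr0n // mul1r.
by rewrite -natrM ler_nat; lia.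
Qed.

Lemma cvg_half_bound (a : nat -> R) (l C : R) :
  (\forall n \near \oo, `|a n - l| <= C * (n./2.+1%:R)^-1) -> a n @[n --> \oo] --> l.
Proof.
move=> h.
have C0 : C * ((n./2.+1)%:R : R)^-1 @[n --> \oo] --> (0 : R).
  by rewrite -(mulr0 C); apply: cvgM; [exact: cvg_cst|exact: cvg_inv_half].
have d0 : a n - l @[n --> \oo] --> (0 : R).
  apply/norm_cvg0P/(@squeeze_cvgr _ _ _ _ (fun=> 0) (fun n => C * ((n./2.+1)%:R)^-1)) => //.
    by apply: filterS h => n ->; rewrite normr_ge0.
  exact: cvg_cst.
rewrite (_ : a = (fun n => (a n - l) + l)); last by apply/funext => n; rewrite subrK.
by rewrite -[X in _ --> X]add0r; apply: cvgD => //; exact: cvg_cst.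
Qed.

Lemma cvg_half_oo : n./2 @[n --> \oo] --> \oo.
Proof.
move=> P [N _ hN]; exists (2 * N)%N => // n /= nN; apply: hN => /=; lia.
Qed.

(** Both bounds come from [ln (1 + x) <= x], applied to [1/n] and to [- 1/(n+1)]. *)
Lemma ln_succ_le (n : nat) : (0 < n)%N ->
  (n.+1%:R : R)^-1 <= ln n.+1%:R - ln n%:R <= (n%:R : R)^-1.
Proof.
move=> n0; have n0' : (0 : R) < n%:R by rewrite ltr0n.
have n1' : (0 : R) < n.+1%:R by rewrite ltr0n.
rewrite -ln_div ?posrE //; apply/andP; split.
- have h : -1 < - (n.+1%:R : R)^-1 by rewrite ltrN2 invf_lt1 // ltr1n.
  have := le_ln1Dx h; rewrite (_ : 1 - _ = (n.+1%:R / n%:R)^-1).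
    by rewrite lnV ?posrE ?divr_gt0 // lerN2.
  by rewrite invf_div -natr1; field; rewrite natr1 gt_eqF.
- have h : -1 < (n%:R : R)^-1 by apply: (@lt_trans _ _ 0); rewrite ?invr_gt0 // ltrN10.
  have := le_ln1Dx h; rewrite (_ : 1 + _ = n.+1%:R / n%:R) //.
  by rewrite -natr1; field; rewrite gt_eqF.
Qed.

(** The sequence is nonincreasing and bounded below by [0], by [ln_succ_le]. *)
Lemma euler_gamma_cvg : (Hn R n - ln n%:R) @[n --> \oo] --> euler_gamma R.
Proof.
have HS n : Hn R n.+1 = Hn R n + (n.+1%:R)^-1 by rewrite /Hn big_nat_recr.
have HE : (fun n => \sum_(1 <= k < n.+1) (k%:R : R)^-1 - ln n%:R) =
    (fun n => Hn R n - ln n%:R) by apply/funext => n; rewrite /Hn big_add1.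
rewrite /euler_gamma HE.
rewrite -(cvg_shiftS (fun n => Hn R n - ln n%:R)).
have ndec : nonincreasing_seq (fun n => Hn R n.+1 - ln n.+1%:R).
  apply/nonincreasing_seqP => n /=; rewrite [Hn R n.+2]HS.
  have /andP[h _] := @ln_succ_le n.+1 isT.
  by move: (_^-1) (ln _) (ln _) (Hn R _) h => a b c d; lra.
have lb n : 0 <= Hn R n.+1 - ln n.+1%:R.
  suff : ln n.+2%:R <= Hn R n.+1.
    have : ln (n.+1%:R : R) <= ln n.+2%:R by rewrite ler_ln ?posrE ?ler_nat.
    by move: (ln _) (ln _) (Hn R _) => a b c; lra.
  elim: n => [|n IH]; rewrite HS.
    rewrite /Hn big_geq // add0r invr1.
    by have := @le_ln1Dx R 1; rewrite (_ : 1 + 1 = 2%:R) //; apply; lra.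
  have /andP[_ h] := @ln_succ_le n.+2 isT.
  by move: (_^-1) (ln _) (ln _) (Hn R _) h IH => a b c d; lra.
have /cvg_ex[l hl] : cvgn (fun n => Hn R n.+1 - ln n.+1%:R).
  by apply: nonincreasing_is_cvgn => //; exists 0 => _ [n _ <-].
suff -> : limn (fun n => Hn R n - ln n%:R) = l by [].
apply: (@cvg_lim R) => //; move: hl.
by rewrite (cvg_shiftS (fun n => Hn R n - ln n%:R)).
Qed.

(** Everything that the limits below use about [n./2], stated over the reals in terms of
    [x = n./2 + 1] so that linear arithmetic applies. *)
Lemma half_bounds (n : nat) : exists2 x : R, 1 <= x &
  ((n./2.+1)%:R = x /\ (n./2)%:R = x - 1 /\ (2 * n./2 + 1)%:R = 2 * x - 1) /\
  [/\ 2 * x - 2 <= (n%:R : R) <= 2 * x - 1, ((n - n./2)%N%:R : R) = n%:R - (x - 1)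
   & (n < 2 * n./2.+1)%N].
Proof.
exists (n./2.+1)%:R; first by rewrite ler1n.
split; first by rewrite natrD natrM -!natr1; split=> //; split; ring.
have e := odd_double_half n.
have e2 : (n%:R : R) = (odd n)%:R + 2 * (n./2)%:R by rewrite -{1}e natrD -mul2n natrM.
split; last by lia.
- by rewrite e2 -natr1; case: (odd n) => /=; apply/andP; split; lra.
- rewrite natrB -?natr1; [ring|lia].
Qed.

Lemma cvg_n_half : n%:R / (n./2.+1)%:R @[n --> \oo] --> (2 : R).
Proof.
apply: (@cvg_half_bound _ _ 2); apply: nearW => n.
have [x x1 [[-> [_ _]] [h _ _]]] := half_bounds n.
have x0 : 0 < x by lra.
rewrite (_ : _ - 2 = (n%:R - 2 * x) / x); last by field; rewrite gt_eqF.
rewrite normrM normfV (gtr0_norm x0) ler_pM2r ?invr_gt0 // ler_norml; lra.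
Qed.

Lemma cvg_half_odd : (n./2)%:R / (2 * n./2 + 1)%:R @[n --> \oo] --> (2^-1 : R).
Proof.
apply: (@cvg_half_bound _ _ 1); apply: nearW => n.
have [x x1 [[-> [-> ->]] [h _ _]]] := half_bounds n.
have x0 : 0 < x by lra.
have y0 : 0 < 2 * x - 1 by lra.
rewrite (_ : _ - _ = - (2 * (2 * x - 1))^-1); last by field; rewrite gt_eqF.
rewrite normrN gtr0_norm ?invr_gt0 ?mulr_gt0 // mul1r lef_pV2 ?posrE ?mulr_gt0 //; lra.
Qed.

Lemma cvg_cohalf_odd : (n - n./2)%:R / (2 * n./2 + 1)%:R @[n --> \oo] --> (2^-1 : R).
Proof.
apply: (@cvg_half_bound _ _ 1); apply: nearW => n.
have [x x1 [[-> [_ ->]] [h -> _]]] := half_bounds n.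
have x0 : 0 < x by lra.
have y0 : 0 < 2 * x - 1 by lra.
rewrite (_ : _ - _ = (n%:R - 2 * x + 3 / 2) / (2 * x - 1)); last by field; rewrite gt_eqF.
rewrite normrM normfV (gtr0_norm y0); apply: ler_pM; rewrite ?invr_ge0 ?(ltW y0) //.
  by rewrite ler_norml; lra.
by rewrite lef_pV2 ?posrE //; lra.
Qed.

Lemma cvg_cohalf : (n - n./2)%:R / (n./2.+1)%:R @[n --> \oo] --> (1 : R).
Proof.
apply: (@cvg_half_bound _ _ 1); apply: nearW => n.
have [x x1 [[-> [_ _]] [h -> _]]] := half_bounds n.
have x0 : 0 < x by lra.
rewrite (_ : _ - 1 = (n%:R - 2 * x + 1) / x); last by field; rewrite gt_eqF.
rewrite normrM normfV (gtr0_norm x0) ler_pM2r ?invr_gt0 // ler_norml; lra.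
Qed.

Lemma cvg_Hn_half : Hn R n./2 - ln n%:R @[n --> \oo] --> euler_gamma R - ln 2.
Proof.
have h1 : Hn R n./2.+1 - ln (n./2.+1)%:R @[n --> \oo] --> euler_gamma R.
  have hS := euler_gamma_cvg; rewrite -(cvg_shiftS (fun n => Hn R n - ln n%:R)) in hS.
  exact: (cvg_comp _ _ cvg_half_oo hS).
have h2 : ln (n%:R / (n./2.+1)%:R : R) @[n --> \oo] --> ln (2 : R).
  by apply: (continuous_cvg _ _ cvg_n_half); exact: continuous_ln.
have h : (Hn R n./2.+1 - ln (n./2.+1)%:R - (n./2.+1%:R)^-1 - ln (n%:R / (n./2.+1)%:R))
    @[n --> \oo] --> euler_gamma R - ln 2.
  by rewrite -[X in _ --> X - _]subr0; apply: cvgB h2; exact: cvgB h1 cvg_inv_half.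
apply: cvg_near_eq h; exists 1%N => // n /= n0.
rewrite ln_div ?posrE ?ltr0n // /Hn big_nat_recr //=; ring.
Qed.

Lemma cvg_Hn_diff : Hn R n - Hn R n./2 @[n --> \oo] --> (ln 2 : R).
Proof.
have h : (Hn R n - ln n%:R - (Hn R n./2 - ln n%:R)) @[n --> \oo] --> (ln 2 : R).
  rewrite [X in _ --> X](_ : _ = euler_gamma R - (euler_gamma R - ln 2)); last by ring.
  exact: cvgB euler_gamma_cvg cvg_Hn_half.
by apply: cvg_near_eq h; apply: nearW => n; ring.
Qed.

End RealSequences.

(** * The elementary factors of the closed form *)

Section ComplexSequences.
Variable R : realType.
Implicit Types (u v : nat -> R[i]^o) (l m : R[i]^o).

Lemma cvgC_cst l : (fun _ : nat => l) @ \oo --> l.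
Proof. exact: cvg_cst. Qed.

Lemma cvgC_mul u v l m : u n @[n --> \oo] --> l -> v n @[n --> \oo] --> m ->
  (u n * v n : R[i]^o) @[n --> \oo] --> (l * m : R[i]^o).
Proof. by move=> ul vm; apply: cvgM ul vm. Qed.

Lemma cvgC_add u v l m : u n @[n --> \oo] --> l -> v n @[n --> \oo] --> m ->
  (u n + v n : R[i]^o) @[n --> \oo] --> (l + m : R[i]^o).
Proof. by move=> ul vm; apply: cvgD ul vm. Qed.

Lemma cvgC_scale (z : R[i]) u l : u n @[n --> \oo] --> l ->
  (z * u n : R[i]^o) @[n --> \oo] --> (z * l : R[i]^o).
Proof. by move=> ul; exact: (@cvgC_mul (fun=> z) u z l (@cvgC_cst z) ul). Qed.

Lemma cvgC_inv u l : u n @[n --> \oo] --> l -> l != 0 ->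
  ((u n)^-1 : R[i]^o) @[n --> \oo] --> (l^-1 : R[i]^o).
Proof. by move=> ul l0; apply: cvgV. Qed.

Lemma cvgC_exp u l k : u n @[n --> \oo] --> l ->
  ((u n) ^+ k : R[i]^o) @[n --> \oo] --> (l ^+ k : R[i]^o).
Proof.
move=> ul; elim: k => [|k IH]; first exact: cvgC_cst.
rewrite exprS; under eq_fun do rewrite exprS.
exact: cvgC_mul ul IH.
Qed.

End ComplexSequences.


Section Factors.
Variable R : realType.
Variables (b c : R[i]).
Hypothesis b_sub_odd : forall k : nat, (2 * k + 1)%:R - b != 0.
Hypothesis b_add_odd : forall k : nat, (2 * k + 1)%:R + b != 0.
Hypothesis costrunc_cvg : (costrunc b m : R[i]^o) @[m --> \oo] --> (c : R[i]^o).

Let B := normc b.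
Let B0 : 0 <= B. Proof. exact: normc_ge0. Qed.

Lemma normc_1B2 : normc (1 - b ^+ 2) <= 1 + B ^+ 2.
Proof. by apply: le_trans (normcB_le _ _) _; rewrite normc1 normcX. Qed.

Lemma normc_1D2 : normc (1 + b ^+ 2) <= 1 + B ^+ 2.
Proof. by apply: le_trans (normcD_le _ _) _; rewrite normc1 normcX. Qed.

(** [hfac b p] is [exp] of this up to [O(p^-3)]; the shape makes sums of it
    telescope. *)
Definition hexp p : R[i] := (1 - b ^+ 2) / 4 * ((p%:R : R)^-1 - (p.+1%:R)^-1)%:C.

Lemma normc_div_le (z w : R[i]) (x y : R) : normc z <= x -> 0 < y -> y <= normc w ->
  normc (z / w) <= x / y.
Proof.
move=> zx y0 yw; rewrite normcM normcV; apply: ler_pM => //.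
- exact: normc_ge0.
- by rewrite invr_ge0 normc_ge0.
- by rewrite lef_pV2 ?posrE // (lt_le_trans y0).
Qed.

(** [hfac b p - 1 = (1 - b^2) / ((2p - b)^2 - 1)] and [hexp p] have the same leading
    term [(1 - b^2) / (4 p^2)]. *)
Lemma hfac_approx : exists2 C : R, 0 <= C & exists p0 : nat, forall p, (p0 <= p)%N ->
  normc (hfac b p * cexp (- hexp p) - 1) <= C / p%:R ^+ 3.
Proof.
pose S := 2 + B ^+ 2; pose C1 := S * (5 + 4 * B + B ^+ 2).
have S0 : 0 <= S by rewrite addr_ge0 ?exprn_ge0.
have C10 : 0 <= C1 by rewrite mulr_ge0 // !addr_ge0 ?mulr_ge0 ?exprn_ge0.
exists (2 * expR 1 * (C1 + S * S)).
  apply: mulr_ge0; first by apply: mulr_ge0 => //; exact: expR_ge0.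
  by apply: addr_ge0 => //; exact: mulr_ge0.
exists (Num.truncn S).+1 => p pS.
have Sp : S <= p%:R.
  by apply: le_trans (ltW (Num.Theory.truncnS_gt S)) _; rewrite ler_nat.
have nS : normc (1 - b ^+ 2) <= S.
  by apply: le_trans normc_1B2 _; rewrite /S lerD2r ler1n.
have p1 : 1 <= (p%:R : R) by move: Sp; rewrite /S; nra.
have BS : 1 + B <= S by rewrite /S; nra.
pose d1 : R[i] := (2 * p)%:R - (1 + b); pose d2 : R[i] := (2 * p + 1)%:R - b.
have p0 : p%:R != 0 :> R[i] by rewrite pnatr_eq0; case: (p) p1 => //; rewrite ler10.
have p2 : p.+1%:R != 0 :> R[i] by rewrite pnatr_eq0.
have d1p : p%:R <= normc d1.
  have := normcB_ge ((2 * p)%:R) (1 + b); have := normcD_le 1 b.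
  rewrite normc1 -/d1 -/B normc_nat natrM.
  by move: (normc d1) (normc (1 + b)) => ? ?; lra.
have d2p : p%:R <= normc d2.
  have := normcB_ge ((2 * p + 1)%:R) b; rewrite -/d2 -/B normc_nat natrD natrM.
  by move: (normc d2) => ?; lra.
have d1n0 : d1 != 0 by rewrite -normc_gt0; lra.
have d2n0 : d2 != 0 by rewrite -normc_gt0; lra.
have d12 : p%:R * p%:R <= normc (d1 * d2).
  by rewrite normcM; apply: ler_pM => //; lra.
have uE : hfac b p = 1 + (1 - b ^+ 2) / (d1 * d2).
  rewrite /hfac (_ : (_ - b) ^+ 2 - 1 = d1 * d2); last by rewrite /d1 /d2 natrD; ring.
  have d12n0 := mulf_neq0 d1n0 d2n0; apply: (mulIf d12n0).
  by rewrite [RHS]mulrDl !divfK // /d1 /d2 natrD; ring.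
have vE : hexp p = (1 - b ^+ 2) / (4 * (p%:R * p.+1%:R)).
  rewrite /hexp rmorphB !fmorphV !rmorph_nat.
  by move: p0 p2; rewrite -natr1; move: (p%:R) => x x0 x1; field; rewrite x0 x1.
have uvE : (1 - b ^+ 2) / (d1 * d2) - hexp p =
    ((1 - b ^+ 2) * (4 * p%:R + 4 * p%:R * b - b ^+ 2 + 1)) /
    (4 * (p%:R * p.+1%:R) * (d1 * d2)).
  rewrite vE; move: d1n0 d2n0 p0 p2; rewrite /d1 /d2 natrD natrM -(natr1 p).
  move: (p%:R) => x h1 h2 h3 h4; field; rewrite ?h1 ?h2 ?h3 ?h4 //.
pose x : R := p%:R; rewrite -/x in p1 Sp d1p d2p d12 *.
have x0 : 0 < x by lra.
have x20 : 0 < x * x by rewrite mulr_gt0.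
have np : normc (p%:R * p.+1%:R : R[i]) = x * (x + 1) by rewrite normcM !normc_nat natr1.
have hv : normc (hexp p) <= S / (x * x).
  rewrite vE; apply: normc_div_le => //.
  rewrite normcM np normc_nat; nra.
have hu : normc ((1 - b ^+ 2) / (d1 * d2)) <= S / (x * x) by apply: normc_div_le.
have huv : normc ((1 - b ^+ 2) / (d1 * d2) - hexp p) <= C1 / x ^+ 3.
  rewrite uvE (_ : C1 / x ^+ 3 = (S * ((5 + 4 * B + B ^+ 2) * x)) / (x * x * (x * x))).
    apply: normc_div_le; last 2 first.
    - by rewrite mulr_gt0.
    - rewrite [4 * _ * _]mulrC [X in _ <= X]normcM [X in _ <= _ * X]normcM np normc_nat.
      by apply: ler_pM; [exact: ltW|exact: ltW|exact: d12|nra].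
    rewrite normcM; apply: ler_pM; rewrite ?normc_ge0 //.
    have h1 := normcD_le (4 * p%:R + 4 * p%:R * b - b ^+ 2) 1.
    have h2 := normcB_le (4 * p%:R + 4 * p%:R * b) (b ^+ 2).
    have h3 := normcD_le (4 * p%:R) (4 * p%:R * b).
    have e4 : normc (4 * p%:R : R[i]) = 4 * x by rewrite normcM !normc_nat.
    have e5 : normc (4 * p%:R * b) = 4 * x * B by rewrite normcM e4.
    rewrite normc1 in h1; rewrite normcX -/B in h2; rewrite e4 e5 in h3.
    have h4 : 0 <= (x - 1) * (1 + B ^+ 2).
      by rewrite mulr_ge0 ?subr_ge0 // addr_ge0 ?exprn_ge0.
    apply: le_trans h1 _; rewrite -lerBrDr; apply: le_trans h2 _.
    rewrite -lerBrDr; apply: le_trans h3 _; lra.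
  by rewrite /C1; field; rewrite gt_eqF.
rewrite uE; apply: le_trans (exp_approx _ _) _.
  apply: le_trans hv _; rewrite ler_pdivrMr // mul1r; nra.
rewrite -[leRHS]mulrA ler_wpM2l ?mulr_ge0 ?expR_ge0 // [leRHS]mulrDl; apply: lerD => //.
apply: le_trans (ler_pM (normc_ge0 _) (normc_ge0 _) hu hv) _.
rewrite (_ : S / (x * x) * (S / (x * x)) = S * S / x ^+ 3 / x); last by field; rewrite gt_eqF.
by rewrite ler_piMr ?invf_le1 // divr_ge0 ?mulr_ge0 // exprn_ge0 // ltW.
Qed.

(** [costrunc b k.+1] is [costrunc b k] times this factor, which is [exp] of [cexpo k]
    up to [O(k^-3)]. *)
Definition cratio k : R[i] := (2 * k + 3)%:R / (2 * k + 1)%:R *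
  (((2 * k + 1)%:R ^+ 2 - b ^+ 2) / (2 * k + 2)%:R ^+ 2).

Definition cexpo k : R[i] :=
  - ((1 + b ^+ 2) / 4 * ((k.+1%:R : R)^-1 - (k.+2%:R)^-1)%:C).

(** Both [cratio k - 1] and [cexpo k] have leading term
    [- (1 + b^2) / (4 (k+1)^2)]. *)
Lemma cratio_approx : exists2 C : R, 0 <= C & exists k0 : nat, forall k, (k0 <= k)%N ->
  normc (cratio k * cexp (- cexpo k) - 1) <= C / k.+1%:R ^+ 3.
Proof.
pose S := 2 + B ^+ 2.
have S0 : 0 <= S by rewrite addr_ge0 ?exprn_ge0.
exists (2 * expR 1 * (2 * S + 2 * S * S)).
  by rewrite !mulr_ge0 ?expR_ge0 // addr_ge0 ?mulr_ge0.
exists (Num.truncn S).+1 => k kS.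
pose x : R := k.+1%:R.
have Sx : S <= x.
  apply: le_trans (ltW (Num.Theory.truncnS_gt S)) _; rewrite ler_nat; exact: leqW.
have nS : normc (1 + b ^+ 2) <= S.
  by apply: le_trans normc_1D2 _; rewrite /S lerD2r ler1n.
have nb : normc (b ^+ 2) <= S by rewrite normcX /S lerDr.
have x1 : 1 <= x by rewrite ler1n.
have x0 : 0 < x by lra.
have x20 : 0 < x * x by rewrite mulr_gt0.
pose X : R[i] := k.+1%:R.
have e1 : (2 * k + 1)%:R = 2 * X - 1 by rewrite /X natrD natrM -natr1; ring.
have e2 : (2 * k + 2)%:R = 2 * X by rewrite /X natrD natrM -natr1; ring.
have e3 : (2 * k + 3)%:R = 2 * X + 1 by rewrite /X natrD natrM -natr1; ring.
have X0 : X != 0 by rewrite pnatr_eq0.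
have X2 : 2 * X - 1 != 0 by rewrite -e1 pnatr_eq0 addn1.
have X3 : X + 1 != 0 by rewrite natr1 pnatr_eq0.
have n2X : x <= normc (2 * X - 1).
  by rewrite -e1 normc_nat /x ler_nat addn1 ltnS leq_pmull.
have nX : normc X = x by rewrite normc_nat.
have nX1 : normc (X + 1) = x + 1 by rewrite natr1 normc_nat natr1.
have vE0 : cexpo k = - ((1 + b ^+ 2) / 4 * (X^-1 - (X + 1)^-1)).
  by rewrite /cexpo rmorphB !fmorphV !rmorph_nat -/X -(natr1 k.+1).
clearbody X.
have uE : cratio k = 1 + (- ((1 + b ^+ 2) / (4 * (X * X)) + b ^+ 2 / (2 * (X * X) * (2 * X - 1)))).
  by rewrite /cratio e1 e2 e3; field; rewrite X0 X2.
have vE : cexpo k = - ((1 + b ^+ 2) / (4 * (X * (X + 1)))).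
  by rewrite vE0; field; rewrite X0 X3.
have uvE : - ((1 + b ^+ 2) / (4 * (X * X)) + b ^+ 2 / (2 * (X * X) * (2 * X - 1))) - cexpo k =
    - ((1 + b ^+ 2) / (4 * (X * X * (X + 1))) + b ^+ 2 / (2 * (X * X) * (2 * X - 1))).
  by rewrite vE; field; rewrite X0 X2 X3.
have hv : normc (cexpo k) <= S / (x * x).
  rewrite vE normcN1; apply: normc_div_le => //.
  rewrite normcM (normcM X) nX nX1 normc_nat; nra.
have hb : normc (b ^+ 2 / (2 * (X * X) * (2 * X - 1))) <= S / (x * x * x).
  apply: normc_div_le => //; first by rewrite mulr_gt0.
  rewrite normcM; apply: ler_pM => //; rewrite ?ltW //.
  by rewrite !normcM nX normc_nat; nra.
have hs : S / (x * x * x) <= S / (x * x).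
  by rewrite ler_wpM2l // lef_pV2 ?posrE ?mulr_gt0 // ler_peMr // ltW.
have hu : normc (- ((1 + b ^+ 2) / (4 * (X * X)) + b ^+ 2 / (2 * (X * X) * (2 * X - 1))))
    <= 2 * S / (x * x).
  rewrite normcN1; apply: le_trans (normcD_le _ _) _.
  rewrite (_ : 2 * S / (x * x) = S / (x * x) + S / (x * x)); last by rewrite -mulrDl; congr (_ / _); ring.
  apply: lerD; last exact: le_trans hs.
  apply: normc_div_le => //.
  by rewrite !normcM nX normc_nat; nra.
have huv : normc (- ((1 + b ^+ 2) / (4 * (X * X)) + b ^+ 2 / (2 * (X * X) * (2 * X - 1))) - cexpo k)
    <= 2 * S / x ^+ 3.
  rewrite uvE normcN1; apply: le_trans (normcD_le _ _) _.
  rewrite (_ : 2 * S / x ^+ 3 = S / (x * x * x) + S / (x * x * x)); last first.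
    by rewrite -mulrDl; congr (_ / _); ring.
  apply: lerD => //; apply: normc_div_le => //; first by rewrite mulr_gt0.
  rewrite (normcM 4) normcM nX1 !normcM nX normc_nat; nra.
rewrite uE; apply: le_trans (exp_approx _ _) _.
  apply: le_trans hv _; rewrite ler_pdivrMr // mul1r; nra.
rewrite -[leRHS]mulrA -/x ler_wpM2l ?mulr_ge0 ?expR_ge0 // [leRHS]mulrDl; apply: lerD => //.
apply: le_trans (ler_pM (normc_ge0 _) (normc_ge0 _) hu hv) _.
rewrite (_ : 2 * S / (x * x) * (S / (x * x)) = 2 * S * S / x ^+ 3 / x); last by field; rewrite gt_eqF.
by rewrite ler_piMr ?invf_le1 // divr_ge0 ?mulr_ge0 // exprn_ge0 // ltW.
Qed.

Lemma costrunc_ratio K m : (K <= m)%N ->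
  \prod_(K <= k < m) cratio k = costrunc b m / costrunc b K.
Proof.
elim: m => [|m IH]; first by rewrite leqn0 => /eqP ->; rewrite big_geq // divff ?costrunc_neq0.
rewrite leq_eqVlt => /predU1P[<-|Km]; first by rewrite big_geq // divff ?costrunc_neq0.
by rewrite big_nat_recr //= IH // costruncS -/(cratio m) mulrAC.
Qed.

Lemma sum_cexpo K m : (K <= m)%N -> \sum_(K <= k < m) cexpo k =
  - ((1 + b ^+ 2) / 4 * ((K.+1%:R : R)^-1 - (m.+1%:R)^-1)%:C).
Proof.
move=> Km; rewrite sumrN -mulr_sumr -rmorph_sum; congr (- (_ * _%:C)).
elim: m Km => [|m IH]; first by rewrite leqn0 => /eqP ->; rewrite big_geq // subrr.
rewrite leq_eqVlt => /predU1P[<-|Km]; first by rewrite big_geq // subrr.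
by rewrite big_nat_recr //= IH // addrA subrK.
Qed.

Lemma cvg_cexp (u : nat -> R[i]^o) (l : R[i]) :
  u n @[n --> \oo] --> (l : R[i]^o) ->
  (cexp (u n) : R[i]^o) @[n --> \oo] --> (cexp l : R[i]^o).
Proof.
move=> ul.
have h : normc (u n - l) @[n --> \oo] --> (0 : R) by exact: normc_cvg0.
apply: (@normc_cvg_le _ _ _ (fun n => normc (cexp l) * (2 * expR 1 * normc (u n - l)))).
  have /cvgrPdist_lt/(_ 1 ltr01) h1 := h.
  apply: filterS h1 => n; rewrite sub0r normrN ger0_norm ?normc_ge0 // => h1.
  rewrite -{1}(subrK l (u n)) cexpD mulrC -{2}(mulr1 (cexp l)) -mulrBr normcM.
  rewrite ler_wpM2l ?normc_ge0 //.
  have h2 : normc (- (u n - l)) <= 1 by rewrite normcN1 ltW.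
  have := exp_approx 0 h2.
  by rewrite addr0 mul1r opprK add0r normc0 mul0r addr0.
rewrite -(mulr0 (normc (cexp l))); apply: cvgM; first exact: cvg_cst.
by rewrite -(mulr0 (2 * expR 1)); apply: cvgM => //; exact: cvg_cst.
Qed.

(** [c / costrunc b K] is the tail [prod_(k >= K) cratio k].  Each finite part of
    the tail, raised to the power [n], is within [O(n / K^2)] of its exponential,
    uniformly in its length; the bound then passes to the limit. *)
Lemma cvg_cratio : ((c / costrunc b n./2) ^+ n *
    cexp ((1 + b ^+ 2) / 4 * (n%:R / (n./2.+1)%:R)%:C) : R[i]^o) @[n --> \oo] -->
  (1 : R[i]^o).
Proof.
have [C C0 [k0 hC]] := cratio_approx.
apply: (@near1_cvg _ _ (fun n => 4 * C * (n./2.+1%:R)^-1)); last first.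
  by rewrite -(mulr0 (4 * C)); apply: cvgM; [exact: cvg_cst|exact: cvg_inv_half].
exists (2 * k0.+1)%N => // n /= nk; set K := n./2.
have k0K : (k0 < K)%N by rewrite /K; lia.
have nK : (n <= 2 * K.+1)%N by rewrite /K; lia.
pose e k := cratio k * cexp (- cexpo k) - 1.
pose M := n%:R * C / K.+1%:R.
have K1 : 0 < (K.+1%:R : R) by rewrite ltr0n.
have K0 : 0 < (K%:R : R) by rewrite ltr0n (leq_ltn_trans _ k0K).
have M0 : 0 <= M by rewrite !mulr_ge0 ?invr_ge0.
have he k : (K <= k)%N -> n%:R * normc (e k) <= M / k.+1%:R ^+ 2.
  move=> Kk; have k1 : 0 < (k.+1%:R : R) by rewrite ltr0n.
  apply: le_trans (ler_wpM2l (ler0n _ _) (hC k _)) _.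
    by apply: leq_trans Kk; exact: ltnW.
  rewrite /M -!mulrA !ler_wpM2l // -invfM lef_pV2 ?posrE ?mulr_gt0 ?exprn_gt0 //.
  by rewrite exprS ler_wpM2r ?exprn_ge0 ?(ltW k1) // ler_nat ltnS.
have tail := prod_tail (w := fun=> n) M0 he.
have bound : M / K%:R <= 4 * C * (K.+1%:R)^-1.
  rewrite /M -mulrA -invfM ler_pdivrMr ?mulr_gt0 //.
  rewrite (_ : 4 * C / K.+1%:R * (K.+1%:R * K%:R) = C * (4 * K%:R)); last first.
    by field; rewrite gt_eqF.
  rewrite mulrC ler_wpM2l // -natrM ler_nat; lia.
have lim : ((costrunc b m / costrunc b K) ^+ n * cexp (n%:R * ((1 + b ^+ 2) / 4 *
     ((K.+1%:R : R)^-1 - (m.+1%:R)^-1)%:C)) : R[i]^o) @[m --> \oo] -->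
   ((c / costrunc b K) ^+ n * cexp (n%:R * ((1 + b ^+ 2) / 4 * ((K.+1%:R : R)^-1 - 0)%:C)) : R[i]^o).
  apply: cvgC_mul.
    apply: cvgC_exp.
    exact: (@cvgC_mul _ (costrunc b) (fun=> (costrunc b K)^-1) c _ costrunc_cvg (@cvgC_cst _ _)).
  apply: cvg_cexp; apply: cvgC_scale; apply: cvgC_scale.
  apply: cvgC_real; apply: cvgB; first exact: cvg_cst.
  exact: cvg_harmonic.
apply: near1_le bound.
have := near1_lim lim (x := M / K%:R).
rewrite subr0 (_ : n%:R * _ = (1 + b ^+ 2) / 4 * (n%:R / K.+1%:R)%:C); last first.
  by rewrite natC mulrCA -rmorphM.
apply; exists K => // m /= Km.
have := tail K m (leqnn K) _ Km; rewrite (leq_ltn_trans _ k0K) // => /(_ isT).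
congr near1.
transitivity ((\prod_(K <= k < m) (cratio k * cexp (- cexpo k))) ^+ n).
  by rewrite -prodrXl; apply: eq_bigr => k _; rewrite /e addrC subrK.
rewrite big_split /= costrunc_ratio // -cexp_sum sumrN sum_cexpo // opprK exprMn.
by rewrite -cexp_natM.
Qed.

End Factors.

Section Asymptotics.
Variable R : realType.
Variables (b c : R[i]).
Hypothesis b_sub_odd : forall k : nat, (2 * k + 1)%:R - b != 0.
Hypothesis b_add_odd : forall k : nat, (2 * k + 1)%:R + b != 0.
Hypothesis costrunc_cvg : (costrunc b m : R[i]^o) @[m --> \oo] --> (c : R[i]^o).

(** This is the limit [(1 + z/A)^w ~ exp (z w / A)]: the error per factor is
    [O(A^-2)], and there are [w = O(A)] factors. *)
Lemma cvg_odd_pow (z : R[i]) (w : nat -> nat) : (forall n, (w n <= n./2.+1)%N) ->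
  ((1 + z / (2 * n./2 + 1)%:R) ^+ w n *
   cexp (- (z * ((w n)%:R / (2 * n./2 + 1)%:R)%:C)) : R[i]^o) @[n --> \oo] -->
  (1 : R[i]^o).
Proof.
move=> wn; pose Z := normc z; have Z0 : 0 <= Z := normc_ge0 z.
apply: (@near1_cvg _ _ (fun n => 2 * expR 1 * Z ^+ 2 * (n./2.+1%:R)^-1)); last first.
  rewrite -(mulr0 (2 * expR 1 * Z ^+ 2)).
  by apply: cvgM; [exact: cvg_cst|exact: cvg_inv_half].
exists (2 * (Num.truncn Z).+1)%N => // n /= nZ.
pose A : R := (2 * n./2 + 1)%:R; pose x : R := n./2.+1%:R.
have xA : x <= A by rewrite ler_nat addn1 ltnS leq_pmull.
have x0 : 0 < x by rewrite ltr0n.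
have A0 : 0 < A by apply: lt_le_trans xA.
have ZA : Z <= A.
  apply: le_trans xA; apply: le_trans (ltW (Num.Theory.truncnS_gt Z)) _.
  rewrite ler_nat; move: nZ; move: (Num.truncn Z) => t; clear; lia.
pose u : R[i] := z / (2 * n./2 + 1)%:R.
have uE : normc u = Z / A by rewrite normcM normcV normc_nat.
have u1 : normc u <= 1 by rewrite uE ler_pdivrMr // mul1r.
pose e := (1 + u) * cexp (- u) - 1.
have he : normc e <= 2 * expR 1 * (Z / A) ^+ 2.
  have := exp_approx u u1.
  by rewrite subrr normc0 add0r -/e uE -expr2.
rewrite (_ : _ * _ = (1 + e) ^+ w n).
  apply: near1_le (near1_pow _ _) _.
  apply: le_trans (ler_wpM2l (ler0n _ _) he) _.
  rewrite mulrCA -[leRHS]mulrA ler_wpM2l ?mulr_ge0 ?expR_ge0 // expr_div_n mulrCA.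
  rewrite ler_wpM2l ?exprn_ge0 //.
  have wx : (w n)%:R <= x by rewrite ler_nat.
  apply: le_trans (ler_wpM2r _ wx) _; first by rewrite invr_ge0 exprn_ge0 // ltW.
  rewrite ler_pdivrMr ?exprn_gt0 // ler_pdivlMl // -expr2.
  by rewrite lerXn2r // nnegrE ltW.
have -> : 1 + e = (1 + u) * cexp (- u) by rewrite /e addrC subrK.
rewrite exprMn -cexp_natM; congr (_ * cexp _).
by rewrite rmorphM fmorphV !rmorph_nat /u mulrN; congr (- _); ring.
Qed.

Lemma cvg_oddD_pow :
  (((2 * n./2 + 1)%:R / ((2 * n./2 + 1)%:R + b)) ^+ n./2 *
   cexp (b * ((n./2)%:R / (2 * n./2 + 1)%:R)%:C) : R[i]^o) @[n --> \oo] --> (1 : R[i]^o).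
Proof.
have h := @cvg_odd_pow b (fun n => n./2) (fun n => leqnSn _).
have := cvgC_inv h (oner_neq0 _); rewrite invr1; apply: cvg_near_eq; apply: nearW => n.
rewrite invfM -cexpN opprK -exprVn; congr (_ ^+ _ * _).
have a0 : (2 * n./2 + 1)%:R != 0 :> R[i] by rewrite pnatr_eq0 addn1.
have := b_add_odd n./2; move: a0; move: (_%:R) => a a0 ab.
by field; rewrite a0 ab.
Qed.

Lemma cvg_oddB_pow :
  (((2 * n./2 + 1)%:R / ((2 * n./2 + 1)%:R - b)) ^+ (n - n./2) *
   cexp (- (b * ((n - n./2)%:R / (2 * n./2 + 1)%:R)%:C)) : R[i]^o) @[n --> \oo] -->
  (1 : R[i]^o).
Proof.
have wn n : (n - n./2 <= n./2.+1)%N by lia.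
have h := @cvg_odd_pow (- b) (fun n => (n - n./2)%N) wn.
have := cvgC_inv h (oner_neq0 _); rewrite invr1; apply: cvg_near_eq; apply: nearW => n.
rewrite invfM -cexpN opprK !mulNr -exprVn; congr (_ ^+ _ * _).
have a0 : (2 * n./2 + 1)%:R != 0 :> R[i] by rewrite pnatr_eq0 addn1.
have := b_sub_odd n./2; move: a0; move: (_%:R) => a a0 ab.
by field; rewrite a0 ab.
Qed.

(** Summation by parts, as [hexp] is a difference. *)
Lemma sum_hexp K m : (K < m)%N ->
  \sum_(K.+1 <= p < m) (m - p)%:R * hexp b p =
  (1 - b ^+ 2) / 4 * ((m - K)%:R / (K.+1)%:R - (Hn R m - Hn R K))%:C.
Proof.
have tel n : (K <= n)%N -> \sum_(K.+1 <= p < n.+1) ((p%:R : R)^-1 - (p.+1%:R)^-1) =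
    (K.+1%:R)^-1 - (n.+1%:R)^-1.
  elim: n => [|n IH]; first by rewrite leqn0 => /eqP ->; rewrite big_geq // subrr.
  rewrite leq_eqVlt => /predU1P[<-|Kn]; first by rewrite big_geq // subrr.
  by rewrite big_nat_recr //= IH // addrA subrK.
have key n : (K <= n)%N -> \sum_(K.+1 <= p < n.+1) (n.+1 - p)%:R *
     ((p%:R : R)^-1 - (p.+1%:R)^-1) = (n.+1 - K)%:R / (K.+1)%:R - (Hn R n.+1 - Hn R K).
  have HS k : Hn R k.+1 = Hn R k + (k.+1%:R)^-1 by rewrite /Hn big_nat_recr.
  elim: n => [|n IH].
    by rewrite leqn0 => /eqP ->; rewrite big_geq // HS subSnn mul1r addrAC subrr add0r subrr.
  rewrite leq_eqVlt => /predU1P[<-|Kn].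
    by rewrite big_geq // HS subSnn mul1r addrAC subrr add0r subrr.
  rewrite (eq_big_nat _ _ (F2 := fun p => (n.+1 - p)%:R * ((p%:R : R)^-1 - (p.+1%:R)^-1) +
     ((p%:R : R)^-1 - (p.+1%:R)^-1))); last first.
    by move=> p /andP[_ pn]; rewrite subSn // -natr1 mulrDl mul1r.
  rewrite big_split /= (tel _ (ltnW Kn)).
  rewrite big_nat_recr //= subnn mul0r addr0 IH // [Hn R n.+2]HS.
  rewrite (_ : (n.+2 - K)%:R = (n.+1 - K)%:R + 1); last by rewrite natr1 -subSn // ltnW.
  move: (_^-1) (_^-1) (Hn R _) (Hn R _) ((_ - _)%:R) => x y z t w; ring.
case: m => // m; rewrite ltnS => Km.
rewrite -key // rmorph_sum mulr_sumr; apply: eq_bigr => p _.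
by rewrite rmorphM rmorph_nat /hexp mulrCA.
Qed.

(** There are at most [n] factors, each raised to a power at most [n] and within
    [O(n^-3)] of its exponential. *)
Lemma cvg_hfac : ((\prod_(n./2.+1 <= p < n) hfac b p ^+ (n - p)) *
    cexp (- ((1 - b ^+ 2) / 4 *
      ((n - n./2)%:R / (n./2.+1)%:R - (Hn R n - Hn R n./2))%:C)) : R[i]^o)
  @[n --> \oo] --> (1 : R[i]^o).
Proof.
have [C C0 [p0 hC]] := @hfac_approx R b.
apply: (@near1_cvg _ _ (fun n => 8 * C * (n./2.+1%:R)^-1)); last first.
  by rewrite -(mulr0 (8 * C)); apply: cvgM; [exact: cvg_cst|exact: cvg_inv_half].
exists (2 * p0.+1)%N => // n /= np; set K := n./2.
have Kp : (p0 < K)%N by rewrite /K; lia.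
have nK : (n <= 2 * K.+1)%N by rewrite /K; lia.
have Kn : (K < n)%N by rewrite /K; lia.
pose e p := hfac b p * cexp (- hexp b p) - 1.
pose M := 4 * n%:R * C / K.+1%:R.
have K1 : 0 < (K.+1%:R : R) by rewrite ltr0n.
have M0 : 0 <= M by rewrite !mulr_ge0 ?invr_ge0.
have he p : (K.+1 <= p)%N -> (n - p)%:R * normc (e p) <= M / p.+1%:R ^+ 2.
  move=> Kp'; have p1 : 0 < (p%:R : R) by rewrite ltr0n (leq_ltn_trans _ Kp').
  have p2 : 0 < (p.+1%:R : R) by rewrite ltr0n.
  apply: (@le_trans _ _ (n%:R * (C / p%:R ^+ 3))).
    apply: ler_pM; rewrite ?normc_ge0 ?ler_nat ?leq_subr //; apply: hC.
    by apply: ltnW; apply: leq_trans Kp'; exact: leq_trans Kp _.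
  rewrite (_ : M / p.+1%:R ^+ 2 = n%:R * (C * (4 / (K.+1%:R * p.+1%:R ^+ 2)))); last first.
    by rewrite /M; field; rewrite gt_eqF //= natr1 gt_eqF.
  rewrite !ler_wpM2l // ler_pdivlMr ?mulr_gt0 ?exprn_gt0 // ler_pdivrMl ?exprn_gt0 //.
  rewrite mulrC -natrX -natrX -!natrM ler_nat.
  (* K + 1 <= p and p + 1 <= 2 p, whence the constant 4 in M. *)
  have pp : (p.+1 <= 2 * p)%N by lia.
  apply: (@leq_trans ((2 * p) ^ 2 * p)); last by rewrite expnMn -mulnA -expnSr mulnC.
  by apply: leq_mul => //; rewrite leq_exp2r.
have := prod_tail (w := fun p => (n - p)%N) M0 he (leqnn _) (ltn0Sn _) Kn.
move=> h; apply: near1_le (_ : M / K.+1%:R <= _); last first.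
  rewrite /M -mulrA -invfM ler_pdivrMr ?mulr_gt0 //.
  rewrite (_ : 8 * C / K.+1%:R * (K.+1%:R * K.+1%:R) = 4 * C * (2 * K.+1%:R)); last first.
    by field; rewrite gt_eqF.
  by rewrite mulrAC ler_wpM2l ?mulr_ge0 // -natrM ler_nat.
move: h; congr near1.
rewrite -sum_hexp // -sumrN cexp_sum -big_split /=; apply: eq_bigr => p _.
by rewrite /e addrC subrK exprMn -cexp_natM mulrN.
Qed.

End Asymptotics.

Section MainAsymptotics.
Variable R : realType.
Variables (beta c : R[i]).
Let b := 2 * beta.
Hypothesis b_sub_odd : forall k : nat, (2 * k + 1)%:R - b != 0.
Hypothesis b_add_odd : forall k : nat, (2 * k + 1)%:R + b != 0.
Hypothesis costrunc_cvg : (costrunc b m : R[i]^o) @[m --> \oo] --> (c : R[i]^o).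

Let s := 3 * beta ^+ 2 + 1 / 4.

(** The exponents split off from the factors of the closed form, and those of the
    claimed equivalent. *)
Let expoD (n : nat) : R[i] :=
  - ((1 + b ^+ 2) / 4 * (n%:R / (n./2.+1)%:R)%:C)
  - b * ((n./2)%:R / (2 * n./2 + 1)%:R)%:C
  + b * ((n - n./2)%:R / (2 * n./2 + 1)%:R)%:C
  + (1 - b ^+ 2) / 4 * ((n - n./2)%:R / (n./2.+1)%:R - (Hn R n - Hn R n./2))%:C.

Let expoG (n : nat) : R[i] :=
  (- (1 / 4) - 3 * beta ^+ 2) * (ln n%:R)%:C + 4 * beta ^+ 2 * (ln 2)%:C
  + s * (Hn R n./2 - euler_gamma R - 1)%:C.

(** In the limit, with [b^2 = 4 beta^2], the constants
    [- (1 + b^2)/2 + (1 - b^2)/4 + s] and the coefficients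
    [- (1 - b^2)/4 + s - b^2] of [ln 2] both vanish. *)
Lemma expo_diff_cvg : (expoD n - expoG n : R[i]^o) @[n --> \oo] --> (0 : R[i]^o).
Proof.
have -> : (0 : R[i]^o) =
  - ((1 + b ^+ 2) / 4) * (2 : R)%:C + (- b) * (2^-1 : R)%:C + b * (2^-1 : R)%:C
  + (1 - b ^+ 2) / 4 * (1 - ln 2 : R)%:C
  + (- s) * (euler_gamma R - ln 2 - (euler_gamma R + 1))%:C
  + - (4 * beta ^+ 2 * (ln 2)%:C).
  by rewrite fmorphV -natC !rmorphB rmorphD rmorph1 /s /b; field.
rewrite (_ : (fun n => expoD n - expoG n) = (fun n =>
  - ((1 + b ^+ 2) / 4) * (n%:R / (n./2.+1)%:R)%:C
  + (- b) * ((n./2)%:R / (2 * n./2 + 1)%:R)%:C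
  + b * ((n - n./2)%:R / (2 * n./2 + 1)%:R)%:C
  + (1 - b ^+ 2) / 4 * ((n - n./2)%:R / (n./2.+1)%:R - (Hn R n - Hn R n./2))%:C
  + (- s) * ((Hn R n./2 - ln n%:R) - (euler_gamma R + 1))%:C
  + - (4 * beta ^+ 2 * (ln 2)%:C))); last first.
  apply/funext => n; rewrite /expoD /expoG /s.
  move: (n%:R / _) ((n./2)%:R / _) ((n - n./2)%:R / (2 * n./2 + 1)%:R).
  move: ((n - n./2)%:R / (n./2.+1)%:R) (Hn R n) (Hn R n./2) (ln n%:R) (ln 2) (euler_gamma R).
  move=> x1 x2 x3 x4 x5 x6 x7 x8 x9; rewrite !rmorphB rmorphD rmorph1.
  by field.
apply: cvgC_add; last exact: cvgC_cst.
apply: cvgC_add; last first.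
  apply: cvgC_scale; apply: cvgC_real; apply: cvgB; last exact: cvg_cst.
  exact: cvg_Hn_half.
apply: cvgC_add; last first.
  apply: cvgC_scale; apply: cvgC_real; apply: cvgB; first exact: cvg_cohalf.
  exact: cvg_Hn_diff.
apply: cvgC_add; last by apply: cvgC_scale; apply: cvgC_real; exact: cvg_cohalf_odd.
apply: cvgC_add; last by apply: cvgC_scale; apply: cvgC_real; exact: cvg_half_odd.
by apply: cvgC_scale; apply: cvgC_real; exact: cvg_n_half.
Qed.

Theorem detM_asymp : asymp (fun n : nat => detM b c n)
    (fun n : nat =>
       cpow (n%:R : R) (- (1 / 4) - 3 * beta ^+ 2)
       * cpow (2 : R) (4 * beta ^+ 2)
       * barnesG (1 - 2 * beta) * barnesG (1 / 2 + beta)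
       * barnesG (3 / 2 + beta)).
Proof.
have [r r1 hr] := three_barnes beta.
pose rh n := r n./2.
have rh1 : (rh n : R[i]^o) @[n --> \oo] --> (1 : R[i]^o).
  exact: (cvg_comp _ _ cvg_half_oo r1).
pose T n := ((c / costrunc b n./2) ^+ n *
    cexp ((1 + b ^+ 2) / 4 * (n%:R / (n./2.+1)%:R)%:C)) *
  (((2 * n./2 + 1)%:R / ((2 * n./2 + 1)%:R + b)) ^+ n./2 *
   cexp (b * ((n./2)%:R / (2 * n./2 + 1)%:R)%:C)) *
  (((2 * n./2 + 1)%:R / ((2 * n./2 + 1)%:R - b)) ^+ (n - n./2) *
   cexp (- (b * ((n - n./2)%:R / (2 * n./2 + 1)%:R)%:C))) *
  ((\prod_(n./2.+1 <= p < n) hfac b p ^+ (n - p)) *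
    cexp (- ((1 - b ^+ 2) / 4 *
      ((n - n./2)%:R / (n./2.+1)%:R - (Hn R n - Hn R n./2))%:C))).
have T1 : (T n : R[i]^o) @[n --> \oo] --> (1 : R[i]^o).
  rewrite -[X in _ --> X]mulr1; apply: cvgC_mul; last exact: cvg_hfac.
  rewrite -[X in _ --> X]mulr1; apply: cvgC_mul; last exact: cvg_oddB_pow.
  rewrite -[X in _ --> X]mulr1; apply: cvgC_mul; last exact: cvg_oddD_pow.
  exact: cvg_cratio.
have TE n : T n * cexp (expoD n) * barnes3 b n./2 = detM b c n.
  rewrite detM_closed // /closedM /T /expoD !cexpD !cexpN.
  move: (cexp_neq0 ((1 + b ^+ 2) / 4 * (n%:R / (n./2.+1)%:R)%:C)).
  move: (cexp_neq0 (b * ((n./2)%:R / (2 * n./2 + 1)%:R)%:C)).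
  move: (cexp_neq0 (b * ((n - n./2)%:R / (2 * n./2 + 1)%:R)%:C)).
  move: (cexp_neq0 ((1 - b ^+ 2) / 4 *
      ((n - n./2)%:R / (n./2.+1)%:R - (Hn R n - Hn R n./2))%:C)).
  move: (cexp _) (cexp _) (cexp _) (cexp _) => x1 x2 x3 x4.
  move: (_ ^+ n) (_ ^+ n./2) (_ ^+ (n - n./2)) (\prod_(_ <= _ < _) _) (barnes3 _ _).
  move=> y1 y2 y3 y4 y5 h1 h2 h3 h4.
  by field; rewrite ?h1 ?h2 ?h3 ?h4.
exists (fun n => T n * cexp (expoD n - expoG n) * (rh n)^-1 - 1).
  have -> : (0 : R[i]^o) = 1 * cexp 0 * 1^-1 + - 1 by rewrite cexp0 invr1 !mulr1 subrr.
  apply: cvgC_add; last exact: cvgC_cst.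
  apply: cvgC_mul; last by apply: cvgC_inv; [exact: rh1|exact: oner_neq0].
  by apply: cvgC_mul; [exact: T1|apply: cvg_cexp; exact: expo_diff_cvg].
have rn0 : \forall n \near \oo, rh n != 0.
  by apply: cvgr_neq0 rh1 _; exact: oner_neq0.
have hrh := cvg_half_oo hr.
apply: filterS2 rn0 hrh => n rn0 hG.
have -> : cpow (n%:R : R) (- (1 / 4) - 3 * beta ^+ 2) * cpow (2 : R) (4 * beta ^+ 2)
       * barnesG (1 - 2 * beta) * barnesG (1 / 2 + beta) * barnesG (3 / 2 + beta) =
    barnes3 b n./2 * cexp (expoG n) * rh n.
  transitivity (cpow (n%:R : R) (- (1 / 4) - 3 * beta ^+ 2) * cpow (2 : R) (4 * beta ^+ 2) *
    (barnesG (1 - 2 * beta) * barnesG (1 / 2 + beta) * barnesG (3 / 2 + beta))).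
    by rewrite !mulrA.
  rewrite hG /expoG !cexpD /cpow -/s -/b -/(rh n).
  by move: (cexp _) (cexp _) (cexp _) (barnes3 _ _) (rh n) => x1 x2 x3 x4 x5; ring.
rewrite -TE cexpD cexpN addrC subrK.
move: (cexp_neq0 (expoG n)) rn0; move: (cexp _) (cexp _) (T n) (barnes3 _ _) (rh n).
by move=> x1 x2 x3 x4 x5 h1 h2; field; rewrite h1 h2.
Qed.

End MainAsymptotics.

(** * The cosine product *)

Section CosineProduct.
Variable R : realType.
Variable b : R[i].
Hypothesis b_sub_odd : forall k : nat, (2 * k + 1)%:R - b != 0.
Hypothesis b_add_odd : forall k : nat, (2 * k + 1)%:R + b != 0.

Implicit Types (f g F G : R -> R[i]) (v w : R[i]) (t x : R).

Let ii : R[i] := 0 +i* 1.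

Let ii2 : ii * ii = -1.
Proof. by apply: complex_ext; rewrite /ii /=; ring. Qed.

Lemma normc_ii : normc (0 +i* 1 : R[i]) = 1.
Proof. by rewrite /= expr0n /= expr1n add0r sqrtr1. Qed.

(** [cos (b x)] and [sin (b x)] for complex [b]. *)
Definition cosb x : R[i] := (cexp (ii * b * x%:C) + cexp (- (ii * b * x%:C))) / 2.
Definition sinb x : R[i] := (cexp (ii * b * x%:C) - cexp (- (ii * b * x%:C))) / (2 * ii).

Let ii0 : ii != 0.
Proof. by rewrite -normc_gt0 normc_ii. Qed.

Let iiV : ii^-1 = - ii.
Proof. by apply: (mulfI ii0); rewrite mulfV // mulrN ii2 opprK. Qed.

Let isD_exp_pm x : isD (fun t => cexp (ii * b * t%:C)) x (ii * b * cexp (ii * b * x%:C)) /\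
  isD (fun t => cexp (- (ii * b * t%:C))) x (- (ii * b * cexp (- (ii * b * x%:C)))).
Proof.
have h : isD (fun t => ii * b * t%:C) x (ii * b).
  by apply: isD_eq (isD_scale _ (isD_id _)) _; rewrite mulr1.
split; first exact: isD_cexp.
by apply: isD_eq (isD_cexp (isD_opp h)) _; rewrite mulNr.
Qed.

Lemma isD_cosb x : isD cosb x (- (b * sinb x)).
Proof.
have [h1 h2] := isD_exp_pm x.
rewrite (_ : cosb = (fun t => 2^-1 * (cexp (ii * b * t%:C) + cexp (- (ii * b * t%:C))))); last first.
  by apply/funext => t; rewrite /cosb mulrC.
apply: isD_eq (isD_scale _ (isD_add h1 h2)) _; rewrite /sinb.
by rewrite invfM iiV; field.
Qed.

Lemma isD_sinb x : isD sinb x (b * cosb x).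
Proof.
have [h1 h2] := isD_exp_pm x.
rewrite (_ : sinb = (fun t => (2 * ii)^-1 * (cexp (ii * b * t%:C) - cexp (- (ii * b * t%:C))))); last first.
  by apply/funext => t; rewrite /sinb mulrC.
by apply: isD_eq (isD_scale _ (isD_sub h1 h2)) _; rewrite /cosb; field.
Qed.

Lemma cosb0 : cosb 0 = 1.
Proof. by rewrite /cosb !mulr0 oppr0 cexp0; field. Qed.

Lemma sinb0 : sinb 0 = 0.
Proof. by rewrite /sinb !mulr0 oppr0 subrr mul0r. Qed.

Lemma isD_cos x : isD (fun t => (cos t)%:C) x (- (sin x)%:C).
Proof. by rewrite -rmorphN; apply: isD_real; exact: is_derive_cos. Qed.

Lemma isD_sin x : isD (fun t => (sin t)%:C) x (cos x)%:C.
Proof. by apply: isD_real; exact: is_derive_sin. Qed.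

Lemma isD_exp F t v n : isD F t v -> isD (fun s => F s ^+ n) t (n%:R * F t ^+ n.-1 * v).
Proof.
move=> h; elim: n => [|n IH]; first by rewrite !mul0r; exact: isD_cst.
under eq_fun do rewrite exprSr.
apply: isD_eq (isD_mul IH h) _; case: n {IH} => [|n] /=; first by rewrite !expr0; ring.
by rewrite exprSr -natr1; ring.
Qed.

Definition primitive F f := forall t, isD F t (f t).

(** The integral of [f] over [[0, pi/2]] is [v], expressed by the increment of an
    antiderivative: all functions integrated in this part have explicit ones, and
    linearity and comparison follow from those of derivatives. *)
Definition intv f v :=
  exists2 F : R -> R[i], primitive F f & F (pi / 2) - F 0 = v.

Lemma intv_lin f g v w (a c : R[i]) : intv f v -> intv g w ->
  intv (fun t => a * f t + c * g t) (a * v + c * w).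
Proof.
move=> [F dF <-] [G dG <-]; exists (fun t => a * F t + c * G t); last by ring.
by move=> t; apply: isD_add; apply: isD_scale.
Qed.

Lemma intv_eq f g v w : intv f v -> (forall t, f t = g t) -> v = w -> intv g w.
Proof. by move=> h /funext <- <-. Qed.

Lemma real_mono (h h' : R -> R) (a a' : R) : a <= a' ->
  (forall t, is_derive t (1 : R) h (h' t)) ->
  (forall t, a <= t <= a' -> 0 <= h' t) -> h a <= h a'.
Proof.
move=> aa' dh h0.
have ch : {within `[a, a'], continuous h}.
  by apply: derivable_within_continuous => t _; case: (dh t).
have [c /[!in_itv]/= ca e] := @MVT_segment R h h' a a' aa' (fun t _ => dh t) ch.
by rewrite -subr_ge0 e mulr_ge0 ?h0 // subr_ge0.
Qed.

(** The factor 2 accounts for the two coordinates. *)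
Lemma intv_bound f g v w : intv f v -> intv g w ->
  (forall t, 0 <= t <= pi / 2 -> normc (f t) <= complex.Re (g t)) ->
  normc v <= 2 * complex.Re w.
Proof.
move=> [F dF <-] [G dG <-] fg.
have p0 : 0 <= pi / 2 :> R by rewrite divr_ge0 // pi_ge0.
have key (p : R[i] -> R) : (forall z w, p (z - w) = p z - p w) ->
    (forall z, `|p z| <= normc z) ->
    (forall t, is_derive t (1 : R) (p \o F) (p (f t))) ->
    `|p (F (pi / 2) - F 0)| <= complex.Re (G (pi / 2) - G 0).
  move=> pB ple hd; rewrite pB ler_norml.
  have ReB (z z' : R[i]) : complex.Re (z - z') = complex.Re z - complex.Re z'.
    by case: z z' => ? ? [].
  have dRG t : is_derive t (1 : R) (fun s => complex.Re (G s)) (complex.Re (g t)).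
    by case: (dG t).
  have h1 := @real_mono (fun s => complex.Re (G s) - p (F s))
     (fun s => complex.Re (g s) - p (f s)) 0 (pi / 2) p0.
  have h2 := @real_mono (fun s => complex.Re (G s) + p (F s))
     (fun s => complex.Re (g s) + p (f s)) 0 (pi / 2) p0.
  have {}h1 := h1 (fun t => is_deriveB (dRG t) (hd t)).
  have {}h2 := h2 (fun t => is_deriveD (dRG t) (hd t)).
  have b0 t : 0 <= t <= pi / 2 -> `|p (f t)| <= complex.Re (g t).
    by move=> ht; apply: le_trans (ple _) (fg t ht).
  have {}h1 : complex.Re (G 0) - p (F 0) <= complex.Re (G (pi / 2)) - p (F (pi / 2)).
    by apply: h1 => t /b0; rewrite ler_norml => /andP[]; lra.
  have {}h2 : complex.Re (G 0) + p (F 0) <= complex.Re (G (pi / 2)) + p (F (pi / 2)).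
    by apply: h2 => t /b0; rewrite ler_norml => /andP[]; lra.
  rewrite ReB; apply/andP; split; lra.
apply: le_trans (normc_le_ReIm _) _; rewrite mulr_natl mulr2n; apply: lerD.
- by apply: (key (@complex.Re R)) => [[? ?] [? ?]|z|t] //; [exact: Re_le_normc|case: (dF t)].
- by apply: (key (@complex.Im R)) => [[? ?] [? ?]|z|t] //; [exact: Im_le_normc|case: (dF t)].
Qed.

Let cosC t : R[i] := (cos t)%:C.
Let sinC t : R[i] := (sin t)%:C.

Let cosC2 t : sinC t * sinC t = 1 - cosC t * cosC t.
Proof. by rewrite -!rmorphM -!expr2 sin2cos2 rmorphB rmorph1. Qed.

(** The antiderivative behind the recurrence of the integrals
    [int_0^(pi/2) cos (b x) cos^n x]. *)
Lemma isD_recurrence (d : R[i]) (C S : R -> R[i]) n x :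
  isD C x (- (d * S x)) -> isD S x (d * C x) ->
  isD (fun t => n.+1%:R * (cosC t ^+ n * sinC t * C t) - d * (cosC t ^+ n.+1 * S t)) x
    ((n.+1%:R ^+ 2 - d ^+ 2) * (C x * cosC x ^+ n.+1) -
     n.+1%:R * n%:R * (C x * cosC x ^+ n.-1)).
Proof.
move=> dC dS.
have h1 := isD_scale n.+1%:R (isD_mul (isD_mul (isD_exp n (isD_cos x)) (isD_sin x)) dC).
have h2 := isD_scale d (isD_mul (isD_exp n.+1 (isD_cos x)) dS).
apply: isD_eq (isD_sub h1 h2) _; rewrite -/(cosC x) -/(sinC x) /=.
rewrite (_ : n%:R * cosC x ^+ n.-1 * - sinC x * sinC x =
  - (n%:R * cosC x ^+ n.-1) * (sinC x * sinC x)); last by ring.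
rewrite cosC2; case: n {h1 h2} => [|n] /=; first by rewrite !expr0 expr1; ring.
by rewrite !exprS -!natr1; ring.
Qed.

Lemma cosC_pihalf : cosC (pi / 2) = 0.
Proof. by rewrite /cosC cos_pihalf. Qed.

Lemma sinC_pihalf : sinC (pi / 2) = 1.
Proof. by rewrite /sinC sin_pihalf. Qed.

Lemma sinC0 : sinC 0 = 0. Proof. by rewrite /sinC sin0. Qed.
Lemma cosC0 : cosC 0 = 1. Proof. by rewrite /cosC cos0. Qed.

(** The values of [int_0^(pi/2) cos (b x) cos^(2m+1) x dx] and of
    [int_0^(pi/2) cos^(2m) x dx], by the recurrence between integrals whose exponents
    differ by [2]. *)
Fixpoint int_odd m : R[i] := if m is k.+1 then
  (2 * k + 3)%:R * (2 * k + 2)%:R / ((2 * k + 3)%:R ^+ 2 - b ^+ 2) * int_odd k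
  else cosb (pi / 2) / (1 - b ^+ 2).

Fixpoint int_even m : R := if m is k.+1 then
  (2 * k + 1)%:R / (2 * k + 2)%:R * int_even k else pi / 2.

(** The antiderivative of [isD_recurrence] takes the same value at both ends, except
    for exponent [1], where it starts the recurrence with [cos (b pi / 2)]. *)
Lemma int_odd_intv m : intv (fun t => cosb t * cosC t ^+ (2 * m + 1)) (int_odd m).
Proof.
elim: m => [|m IH].
  have n1 : 1 - b ^+ 2 != 0.
    by have := sqrB_neq0 b_sub_odd b_add_odd 0; rewrite expr1n.
  exists (fun t => (1 - b ^+ 2)^-1 *
    (1%:R * (cosC t ^+ 0 * sinC t * cosb t) - b * (cosC t ^+ 1 * sinb t))).
    move=> t; apply: isD_eq (isD_scale _ (isD_recurrence 0 (isD_cosb t) (isD_sinb t))) _.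
    by rewrite mulr0 mul0r subr0 expr1n mulrA mulVf // mul1r.
  rewrite /= cosC_pihalf sinC_pihalf sinC0 cosC0 sinb0 cosb0 !expr0 !expr1.
  by field; exact: n1.
have n1 := sqrB_neq0 b_sub_odd b_add_odd m.+1.
rewrite (_ : (2 * m.+1 + 1 = (2 * m + 2).+1)%N) in n1 *; last by lia.
have h : intv (fun t => ((2 * m + 2).+1%:R ^+ 2 - b ^+ 2) * (cosb t * cosC t ^+ (2 * m + 2).+1) -
     (2 * m + 2).+1%:R * (2 * m + 2)%:R * (cosb t * cosC t ^+ (2 * m + 2).-1)) 0.
  exists (fun t => (2 * m + 2).+1%:R * (cosC t ^+ (2 * m + 2) * sinC t * cosb t)
       - b * (cosC t ^+ (2 * m + 2).+1 * sinb t)).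
    by move=> t; apply: isD_recurrence; [exact: isD_cosb|exact: isD_sinb].
  rewrite cosC_pihalf sinC0 sinb0 !expr0n /= addn2 /=; ring.
apply: intv_eq (intv_lin (((2 * m + 2).+1%:R ^+ 2 - b ^+ 2)^-1)
   ((2 * m + 2).+1%:R * (2 * m + 2)%:R / ((2 * m + 2).+1%:R ^+ 2 - b ^+ 2)) h IH) _ _.
  move=> t; rewrite (_ : ((2 * m + 2).-1 = 2 * m + 1)%N); last by lia.
  move: n1; move: ((2 * m + 2).+1%:R) ((2 * m + 2)%:R) => x y n1.
  by field; exact: n1.
by rewrite /= mulr0 add0r (_ : ((2 * m + 2).+1 = 2 * m + 3)%N) //; lia.
Qed.

Lemma int_even_intv m : intv (fun t => cosC t ^+ (2 * m)) (int_even m)%:C.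
Proof.
elim: m => [|m IH].
  exists (fun t => t%:C); last by rewrite subr0.
  by move=> t; rewrite expr0; exact: isD_id.
have h : intv (fun t => ((2 * m + 1).+1%:R ^+ 2 - 0 ^+ 2) * (1 * cosC t ^+ (2 * m + 1).+1) -
     (2 * m + 1).+1%:R * (2 * m + 1)%:R * (1 * cosC t ^+ (2 * m + 1).-1)) 0.
  exists (fun t => (2 * m + 1).+1%:R * (cosC t ^+ (2 * m + 1) * sinC t * 1)
       - 0 * (cosC t ^+ (2 * m + 1).+1 * 0)).
    move=> t; apply: (@isD_recurrence 0 (fun=> 1) (fun=> 0)).
      by rewrite mul0r oppr0; exact: isD_cst.
    by rewrite mul0r; exact: isD_cst.
  rewrite cosC_pihalf sinC0 !expr0n /= addn1 /=; ring.
have n1 : (2 * m + 1).+1%:R != 0 :> R[i] by rewrite pnatr_eq0.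
apply: intv_eq (intv_lin (((2 * m + 1).+1%:R ^+ 2)^-1)
   ((2 * m + 1)%:R / (2 * m + 1).+1%:R) h IH) _ _.
  move=> t; rewrite (_ : ((2 * m + 1).-1 = 2 * m)%N); last by lia.
  rewrite (_ : (2 * m.+1 = (2 * m + 1).+1)%N); last by lia.
  move: n1; move: ((2 * m + 1).+1%:R) ((2 * m + 1)%:R) => x y n1.
  by field; exact: n1.
rewrite /= mulr0 add0r (_ : ((2 * m + 1).+1 = 2 * m + 2)%N); last by lia.
by rewrite !rmorphM fmorphV !rmorph_nat.
Qed.

Lemma int_even_gt0 m : 0 < int_even m.
Proof.
elim: m => [|m IH] /=; first by rewrite divr_gt0 ?pi_gt0.
by rewrite mulr_gt0 // divr_gt0 // ltr0n ?addn1 ?addn2.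
Qed.

Lemma cosb_sinb_bound t : 0 <= t <= 2 ->
  normc (cosb t) <= expR (2 * normc b) /\ normc (sinb t) <= expR (2 * normc b).
Proof.
move=> /andP[t0 t2]; set L := expR _.
have hz : normc (ii * b * t%:C) <= 2 * normc b.
  rewrite !normcM normc_ii mul1r normc_real ger0_norm // mulrC.
  by rewrite ler_wpM2r ?normc_ge0.
have h1 : normc (cexp (ii * b * t%:C)) <= L.
  by apply: le_trans (normc_cexp_le _) _; rewrite ler_expR.
have h2 : normc (cexp (- (ii * b * t%:C))) <= L.
  by apply: le_trans (normc_cexp_le _) _; rewrite ler_expR normcN1.
have n2 : normc (2 : R[i]) = 2 by exact: (normc_nat R 2).
split.
- rewrite /cosb normcM normcV n2 ler_pdivrMr //.
  apply: le_trans (normcD_le _ _) _; lra.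
- rewrite /sinb normcM normcV normcM normc_ii n2 mulr1 ler_pdivrMr //.
  apply: le_trans (normcB_le _ _) _; lra.
Qed.

Lemma normc_cosC t : normc (cosC t) <= 1.
Proof. by rewrite normc_real ler_norml cos_geN1 cos_le1. Qed.

Lemma normc_sinC t : normc (sinC t) <= 1.
Proof. by rewrite normc_real ler_norml sin_geN1 sin_le1. Qed.

(** The function is even, so its Taylor expansion at [0] has no linear term. *)
Lemma cosb_cos_quadratic : exists2 M : R, 0 <= M &
  forall t, 0 <= t <= pi / 2 -> normc (cosb t * cosC t - 1) <= M * t ^+ 2.
Proof.
pose B := normc b; have B0 : 0 <= B := normc_ge0 b.
pose L := expR (2 * B); have L0 : 0 <= L := expR_ge0 _.
pose f1 t := - (b * sinb t) * cosC t + cosb t * - sinC t.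
pose f2 t := (- (b * (b * cosb t)) * cosC t + - (b * sinb t) * - sinC t) +
  (- (b * sinb t) * - sinC t + cosb t * - cosC t).
have d1 t : isD (fun s => cosb s * cosC s) t (f1 t).
  by apply: isD_mul; [exact: isD_cosb|exact: isD_cos].
have d2 t : isD f1 t (f2 t).
  apply: isD_add; apply: isD_mul; first by apply: isD_opp; apply: isD_scale; exact: isD_sinb.
  - exact: isD_cos.
  - exact: isD_cosb.
  - by apply: isD_opp; exact: isD_sin.
pose M2 := (B + 1) ^+ 2 * L.
have M20 : 0 <= M2 by rewrite mulr_ge0 // exprn_ge0 // addr_ge0.
have bnd t : 0 <= t <= 2 -> normc (f2 t) <= M2.
  move=> /cosb_sinb_bound[]; rewrite -/B -/L => hc hs.
  have pr (z w : R[i]) : normc w <= 1 -> normc (z * w) <= normc z.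
    by move=> w1; rewrite normcM ler_piMr ?normc_ge0.
  have c1 := normc_cosC t; have s1 := normc_sinC t.
  have a1 : normc (- (b * (b * cosb t)) * cosC t) <= B * (B * L).
    apply: le_trans (pr _ _ c1) _; rewrite normcN1 normcM [X in _ * X]normcM -/B.
    by do 2 apply: ler_wpM2l => //.
  have a2 : normc (- (b * sinb t) * - sinC t) <= B * L.
    apply: le_trans (pr _ _ _) _; first by rewrite normcN1.
    by rewrite normcN1 normcM -/B ler_wpM2l.
  have a3 : normc (cosb t * - cosC t) <= L.
    by apply: le_trans (pr _ _ _) _; first by rewrite normcN1.
  rewrite /f2 (_ : M2 = (B * (B * L) + B * L) + (B * L + L)); last by rewrite /M2; ring.
  apply: le_trans (normcD_le _ _) _; apply: lerD.
    by apply: le_trans (normcD_le _ _) _; exact: lerD.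
  by apply: le_trans (normcD_le _ _) _; exact: lerD.
have /andP[p0 p2] := @pihalf_02 R.
have bnd1 t : 0 <= t <= 2 -> normc (f1 t) <= 2 * M2 * t.
  move=> /andP[t0 t2].
  have := @isD_mean_value R f1 f2 0 t M2 t0 d2.
  rewrite {2}/f1 sinb0 sinC0 mulr0 oppr0 mul0r mulr0 addr0 !subr0; apply.
  by move=> x /andP[x0 xt]; apply: bnd; rewrite x0 /= (le_trans xt).
exists (4 * M2); first by rewrite mulr_ge0.
move=> t /andP[t0 tp].
have := @isD_mean_value R (fun s => cosb s * cosC s) f1 0 t (2 * M2 * t) t0 d1.
rewrite cosb0 cosC0 mulr1 subr0 => h.
rewrite (_ : 4 * M2 * t ^+ 2 = 2 * (2 * M2 * t) * t); last by ring.
apply: h => x /andP[x0 xt]; apply: le_trans (bnd1 x _) _.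
  by rewrite x0 /= (le_trans xt) // (le_trans tp) // ltW.
by rewrite ler_wpM2l // mulr_ge0.
Qed.

(** The derivative of [sin x - x cos x] is [x sin x >= 0]. *)
Lemma x_cos_le_sin t : 0 <= t <= pi / 2 -> t * cos t <= sin t :> R.
Proof.
move=> /andP[t0 tp].
have d x : is_derive x (1 : R) (sin - id * cos) (x * sin x).
  apply: is_derive_eq; rewrite /GRing.scale /=; ring.
have := @real_mono (sin - id * cos) (fun x => x * sin x) 0 t t0 d _.
rewrite [X in X <= _](_ : _ = 0) ?[X in _ <= X](_ : _ = sin t - t * cos t) // ?subr_ge0; last first.
  by rewrite /= -[LHS]/(sin 0 - 0 * cos 0) sin0 mul0r subr0.
apply=> x /andP[x0 xt]; rewrite mulr_ge0 // sin_ge0_pi // x0 /=.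
apply: le_trans xt _; apply: le_trans tp _.
by rewrite ler_pdivrMr // ler_peMr ?pi_ge0 // ler1n.
Qed.

(** The integrands differ by [(cos (b x) cos x - 1) cos^(2m) x], which is at most
    [M x^2 cos^(2m) x <= M sin^2 x cos^(2m-2) x] in modulus; the integral of the last
    function is a difference of consecutive even integrals, smaller than the even
    integral itself by a factor [2m - 1]. *)
Lemma int_odd_int_even : exists2 M : R, 0 <= M & forall m,
  normc (int_odd m.+1 / (int_even m.+1)%:C - 1) <= M / m.+1%:R.
Proof.
have [M M0 hM] := cosb_cos_quadratic.
exists (2 * M); first by rewrite mulr_ge0.
move=> m; have W0 := int_even_gt0 m.+1.
have h1 := intv_lin 1 (-1) (int_odd_intv m.+1) (int_even_intv m.+1).
have h2 := intv_lin M%:C (- M%:C) (int_even_intv m) (int_even_intv m.+1).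
have := intv_bound h1 h2; rewrite mul1r mulN1r.
have -> : complex.Re (M%:C * (int_even m)%:C + - M%:C * (int_even m.+1)%:C) =
    M * (int_even m.+1 / (2 * m + 1)%:R).
  rewrite -rmorphN -!rmorphM -rmorphD /=.
  have a1 : (2 * m + 1)%:R != 0 :> R by rewrite pnatr_eq0 addn1.
  have a2 : (2 * m + 2)%:R = (2 * m + 1)%:R + 1 :> R by rewrite natr1; congr _%:R; lia.
  have a3 : (2 * m + 1)%:R + 1 != 0 :> R by rewrite -a2 pnatr_eq0 addn2.
  rewrite a2; move: a1 a3; move: (int_even m) ((2 * m + 1)%:R) => x y a1 a3.
  by field; rewrite a1 a3.
move=> h; have {}h := h _.
have nW : normc (int_even m.+1)%:C = int_even m.+1 by rewrite normc_real gtr0_norm.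
have Wn0 : (int_even m.+1)%:C != 0 by rewrite -normc_gt0 nW.
rewrite (_ : _ - 1 = (int_odd m.+1 - (int_even m.+1)%:C) / (int_even m.+1)%:C); last first.
  by rewrite mulrBl divff.
rewrite normcM normcV nW ler_pdivrMr //.
apply: le_trans (h _) _; last first.
  rewrite [leRHS](_ : _ = 2 * (M * (int_even m.+1 / m.+1%:R))); last by ring.
  apply: ler_wpM2l => //; apply: ler_wpM2l => //; apply: ler_wpM2l; first exact: ltW.
  by rewrite lef_pV2 ?posrE ?ltr0n ?addn1 // ler_nat ltnS leq_pmull.
move=> t ht; have /andP[t0 tp] := ht.
have c0 : 0 <= cos t by apply: cos_ge0_pihalf; rewrite tp (le_trans _ t0) // oppr_le0 ltW // divr_gt0 ?pi_gt0.
have -> : 1 * (cosb t * cosC t ^+ (2 * m.+1 + 1)) + -1 * cosC t ^+ (2 * m.+1) =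
   (cosb t * cosC t - 1) * cosC t ^+ (2 * m.+1) by rewrite exprD expr1; ring.
have -> : complex.Re (M%:C * cosC t ^+ (2 * m) + - M%:C * cosC t ^+ (2 * m.+1)) =
   M * ((1 - cos t ^+ 2) * cos t ^+ (2 * m)).
  rewrite -!rmorphXn -rmorphN -!rmorphM -rmorphD /=.
  by rewrite mulnS exprD; ring.
rewrite normcM normcX normc_real ger0_norm //.
apply: le_trans (ler_wpM2r (exprn_ge0 _ c0) (hM t ht)) _.
rewrite -mulrA ler_wpM2l // mulnS.
rewrite exprD mulrA ler_wpM2r ?exprn_ge0 // -exprMn -sin2cos2.
by rewrite lerXn2r ?nnegrE ?mulr_ge0 // ?x_cos_le_sin // (le_trans _ (x_cos_le_sin ht)) // mulr_ge0.
Qed.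

(** The constant [2 cos (pi b / 2) / pi]. *)
Definition cosconst : R[i] := cosb (pi / 2) / (pi / 2 : R)%:C.

(** Multiplying out the recurrences of the two families of integrals produces the
    partial products of the cosine and of Wallis. *)
Lemma costrunc_int_odd m : costrunc b m * (int_odd m * (((2 * m + 1)%:R ^+ 2 - b ^+ 2) / (2 * m + 1)%:R ^+ 2)) =
  cosconst * (int_even m)%:C.
Proof.
have p0 : (pi / 2 : R)%:C != 0.
  by rewrite -normc_gt0 normc_real gtr0_norm ?divr_gt0 ?pi_gt0.
elim: m => [|m IH].
  have n1 : 1 - b ^+ 2 != 0 by have := sqrB_neq0 b_sub_odd b_add_odd 0; rewrite expr1n.
  rewrite /cosconst /= /costrunc big_ord0 muln0 !expr1n !mulr1 mul1r divr1 divfK //.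
  by rewrite divfK.
have n1 := sqrB_neq0 b_sub_odd b_add_odd m; have n2 := sqrB_neq0 b_sub_odd b_add_odd m.+1.
have a1 : (2 * m + 1)%:R != 0 :> R[i] by rewrite pnatr_eq0 addn1.
have a2 : (2 * m + 2)%:R != 0 :> R[i] by rewrite pnatr_eq0 addn2.
have a3 : (2 * m + 3)%:R != 0 :> R[i] by rewrite pnatr_eq0 addn3.
rewrite (_ : (2 * m.+1 + 1 = 2 * m + 3)%N) in n2 *; last by lia.
have -> : (int_even m.+1)%:C = (2 * m + 1)%:R / (2 * m + 2)%:R * (int_even m)%:C.
  by rewrite /= !rmorphM fmorphV !rmorph_nat.
rewrite [RHS]mulrCA -IH costruncS /=.
move: n1 n2 a1 a2 a3; move: (costrunc b m) (int_odd m) ((2 * m + 1)%:R) ((2 * m + 2)%:R) ((2 * m + 3)%:R).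
move=> x y A1 A2 A3 n1 n2 a1 a2 a3.
by field; rewrite n2 a1 a2 a3.
Qed.

Let xcor m : R[i] := int_odd m / (int_even m)%:C *
  (((2 * m + 1)%:R ^+ 2 - b ^+ 2) / (2 * m + 1)%:R ^+ 2).

Let costrunc_xcor m : costrunc b m * xcor m = cosconst.
Proof.
have Wn0 : (int_even m)%:C != 0 by rewrite -normc_gt0 normc_real gtr0_norm ?int_even_gt0.
apply: (mulIf Wn0); rewrite -costrunc_int_odd -[LHS]mulrA; congr (_ * _).
by rewrite /xcor [LHS]mulrAC divfK.
Qed.

Let xcor_cvg : (xcor m : R[i]^o) @[m --> \oo] --> (1 : R[i]^o).
Proof.
have [M M0 hM] := int_odd_int_even.
have inv0 : (m.+1%:R : R)^-1 @[m --> \oo] --> (0 : R) by exact: cvg_harmonic.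
rewrite -[X in _ --> X](mulr1 (1 : R[i])); apply: cvgC_mul.
  rewrite -(cvg_shiftS (fun m => int_odd m / (int_even m)%:C : R[i]^o)).
  apply: (@normc_cvg_le _ _ _ (fun m => M * (m.+1%:R)^-1)); first exact: nearW.
  by rewrite -(mulr0 M); apply: cvgM => //; exact: cvg_cst.
apply: (@normc_cvg_le _ _ _ (fun m => normc b ^+ 2 * (m.+1%:R)^-1)); last first.
  by rewrite -(mulr0 (normc b ^+ 2)); apply: cvgM => //; exact: cvg_cst.
apply: nearW => m; have a1 : (2 * m + 1)%:R != 0 :> R[i] by rewrite pnatr_eq0 addn1.
rewrite (_ : _ - 1 = - (b ^+ 2 / (2 * m + 1)%:R ^+ 2)); last first.
  by rewrite mulrBl divff ?expf_neq0 // addrAC subrr sub0r.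
rewrite normcN1 normcM normcX normcV normcX normc_nat ler_wpM2l ?exprn_ge0 ?normc_ge0 //.
rewrite lef_pV2 ?posrE ?exprn_gt0 ?ltr0n ?addn1 // -natrX ler_nat.
apply: (@leq_trans (2 * m).+1); first by rewrite ltnS leq_pmull.
by rewrite -[X in (X <= _)%N]expn1; apply: leq_pexp2l.
Qed.

Lemma costrunc_cosconst : (costrunc b m : R[i]^o) @[m --> \oo] --> (cosconst : R[i]^o).
Proof.
have h : (cosconst * (xcor m)^-1 : R[i]^o) @[m --> \oo] --> (cosconst * 1^-1 : R[i]^o).
  by apply: cvgC_scale; apply: cvgC_inv; [exact: xcor_cvg|exact: oner_neq0].
rewrite invr1 mulr1 in h; apply: cvg_near_eq h.
have x0 : \forall m \near \oo, xcor m != 0.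
  by apply: cvgr_neq0 xcor_cvg _; exact: oner_neq0.
by apply: filterS x0 => m x0; rewrite -(costrunc_xcor m) mulfK.
Qed.

(** All partial products are nonzero, and [cosconst] is one of them times a correction
    that tends to [1]. *)
Lemma cosconst_neq0 : cosconst != 0.
Proof.
have x0 : \forall m \near \oo, xcor m != 0.
  by apply: cvgr_neq0 xcor_cvg _; exact: oner_neq0.
have [m xm] := filter_ex x0.
by rewrite -(costrunc_xcor m) mulf_neq0 // costrunc_neq0.
Qed.

End CosineProduct.

(** * Fourier coefficients *)

Section Fourier.
Variable R : realType.
Implicit Types (x t : R) (k : int) (beta : R[i]).

Let mu := @lebesgue_measure R.

(** The values of [f] at the two end points do not matter, which is essential for a
    symbol with jumps. *)
Lemma Rintegral_oo (f g G : R -> R) (a a' : R) (b0 b1 : bool) : a < a' ->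
  (forall t, is_derive t (1 : R) G (g t)) -> continuous g ->
  (forall t, a < t < a' -> f t = g t) ->
  (\int[mu]_(t in [set` Interval (BSide b0 a) (BSide b1 a')]) (f t)%:E)%E =
  (G a' - G a)%:E.
Proof.
move=> aa' dG cg fg.
have mg : measurable_fun `]a, a'[ g.
  by apply: measurable_funTS; exact: measurable_realfun.continuous_measurable_fun.
have mf : measurable_fun `]a, a'[ f.
  by apply: eq_measurable_fun mg => t; rewrite inE /= in_itv /= => /fg ->.
rewrite integral_itv_bndoo; last exact/measurable_realfun.measurable_EFinP.
have -> : (\int[mu]_(t in `]a, a'[) (f t)%:E = \int[mu]_(t in `]a, a'[) (g t)%:E)%E.
  by apply: eq_integral => t; rewrite inE /= in_itv /= => /fg ->.
rewrite -(@integral_itv_bndoo _ _ _ _ true false); last exact/measurable_realfun.measurable_EFinP.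
rewrite (@continuous_FTC2 _ g G) //.
- by apply: continuous_subspaceT.
- have cG : continuous G.
    move=> t; have [dt _] := dG t.
    by apply: differentiable_continuous; apply/derivable1_diffP.
  split.
  + by move=> t _; case: (dG t).
  + exact: cvg_at_right_filter (cG a).
  + exact: cvg_at_left_filter (cG a').
- by move=> t _; rewrite derive1E; case: (dG t).
Qed.

Lemma Rintegral_two_pieces (f g1 g2 G1 G2 : R -> R) (a a1 a2 : R) : a < a1 -> a1 < a2 ->
  (forall t, is_derive t (1 : R) G1 (g1 t)) -> continuous g1 ->
  (forall t, is_derive t (1 : R) G2 (g2 t)) -> continuous g2 ->
  (forall t, a < t < a1 -> f t = g1 t) -> (forall t, a1 < t < a2 -> f t = g2 t) ->
  \int[mu]_(t in `[a, a2]) f t = (G1 a1 - G1 a) + (G2 a2 - G2 a1).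
Proof.
move=> h1 h2 dG1 cg1 dG2 cg2 f1 f2.
have mo (u v : R) (g : R -> R) b0 b1 : continuous g -> (forall t, u < t < v -> f t = g t) ->
   u < v -> measurable_fun [set` Interval (BSide b0 u) (BSide b1 v)] f.
  move=> cg fg uv.
  have mf : measurable_fun `]u, v[ f.
    have mg : measurable_fun `]u, v[ g.
      by apply: measurable_funTS; exact: measurable_realfun.continuous_measurable_fun.
    by apply: eq_measurable_fun mg => t; rewrite inE /= in_itv /= => /fg ->.
  have : measurable_fun ([set u] `|` (`]u, v[ `|` [set v])) f.
    apply/measurable_funU; [exact: measurable_set1|by apply: measurableU|].
    split; first exact: measurable_fun_set1.
    apply/measurable_funU; [exact: measurable_itv|exact: measurable_set1|].
    by split => //; exact: measurable_fun_set1.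
  apply: measurable_funS => //.
    by apply: measurableU => //; apply: measurableU.
  move=> t /=; rewrite in_itv /= => /andP[ut tv].
  have ut' : u <= t by case: b0 ut => //= /ltW.
  have tv' : t <= v by case: b1 tv => //= /ltW.
  have [->|tu] := eqVneq t u; first by left.
  have [->|tv''] := eqVneq t v; first by right; right.
  by right; left; rewrite /= in_itv /= !lt_neqAle ut' tv' eq_sym tu tv''.
have setE : `[a, a2]%classic = [set` Interval (BLeft a) (BLeft a1)] `|` [set` Interval (BLeft a1) (BRight a2)].
  by rewrite -itv_bndbnd_setU // bnd_simp ltW.
rewrite /Rintegral setE integral_setU //=.
- rewrite (Rintegral_oo _ _ h1 dG1 cg1 f1) (Rintegral_oo _ _ h2 dG2 cg2 f2).
  by rewrite -EFinD.
- apply/measurable_realfun.measurable_EFinP.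
  by apply/measurable_funU => //; split; [exact: mo cg1 f1 h1|exact: mo cg2 f2 h2].
- apply/disj_setPS => t [] /=; rewrite !in_itv /= => /andP[_ ta] /andP[ta' _].
  by move: ta; rewrite ltNge ta'.
Qed.

Lemma cintegral_two_pieces (f g1 g2 G1 G2 g1' g2' : R -> R[i]) (a a1 a2 : R) :
  a < a1 -> a1 < a2 ->
  (forall t, isD G1 t (g1 t)) -> (forall t, isD g1 t (g1' t)) ->
  (forall t, isD G2 t (g2 t)) -> (forall t, isD g2 t (g2' t)) ->
  (forall t, a < t < a1 -> f t = g1 t) -> (forall t, a1 < t < a2 -> f t = g2 t) ->
  cintegral `[a, a2] f = (G1 a1 - G1 a) + (G2 a2 - G2 a1).
Proof.
move=> h1 h2 dG1 dg1 dG2 dg2 f1 f2.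
have cont (h h' : R -> R) : (forall t, is_derive t (1 : R) h (h' t)) -> continuous h.
  move=> dh t; have [dt _] := dh t.
  by apply: differentiable_continuous; apply/derivable1_diffP.
have ReB (z w : R[i]) : complex.Re (z - w) = complex.Re z - complex.Re w.
  by case: z w => ? ? [].
have ImB (z w : R[i]) : complex.Im (z - w) = complex.Im z - complex.Im w.
  by case: z w => ? ? [].
apply: complex_ext; rewrite /cintegral /=.
- rewrite ReD !ReB.
  apply: (@Rintegral_two_pieces _ (fun t => complex.Re (g1 t)) (fun t => complex.Re (g2 t))
    (fun t => complex.Re (G1 t)) (fun t => complex.Re (G2 t)) _ _ _ h1 h2).
  + by move=> t; case: (dG1 t).
  + by apply: cont => t; case: (dg1 t) => h _; exact: h.
  + by move=> t; case: (dG2 t).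
  + by apply: cont => t; case: (dg2 t) => h _; exact: h.
  + by move=> t /f1 ->.
  + by move=> t /f2 ->.
- rewrite ImD !ImB.
  apply: (@Rintegral_two_pieces _ (fun t => complex.Im (g1 t)) (fun t => complex.Im (g2 t))
    (fun t => complex.Im (G1 t)) (fun t => complex.Im (G2 t)) _ _ _ h1 h2).
  + by move=> t; case: (dG1 t).
  + by apply: cont => t; case: (dg1 t) => _ h; exact: h.
  + by move=> t; case: (dG2 t).
  + by apply: cont => t; case: (dg2 t) => _ h; exact: h.
  + by move=> t /f1 ->.
  + by move=> t /f2 ->.
Qed.

Let ii : R[i] := 0 +i* 1.

Let ii0 : ii != 0.
Proof. by rewrite -normc_gt0 normc_ii. Qed.

Lemma cexp_ii x : cexp (ii * x%:C) = cos x +i* sin x.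
Proof.
rewrite (_ : ii * x%:C = 0 +i* x); first by rewrite /cexp /= expR0 mul1r.
by apply: complex_ext; rewrite /ii /=; ring.
Qed.

Lemma expiE x : expi x = cexp (ii * x%:C).
Proof. by rewrite cexp_ii /expi /cexp /= expR0 mul1r. Qed.

Lemma expiD x t : expi (x + t) = expi x * expi t.
Proof. by rewrite !expiE -cexpD rmorphD mulrDr. Qed.

Lemma expi_2pi : expi (2 * pi) = 1 :> R[i].
Proof. by rewrite expiE cexp_ii mulr_natl cos2pi sin2pi. Qed.

(** [cos x = 1 - 2 sin^2 (x/2)]. *)
Lemma cos_lt1 x : 0 < x < 2 * pi -> cos x < 1.
Proof.
move=> /andP[x0 x2]; rewrite (_ : x = x / 2 + x / 2); last by field.
have : 0 < sin (x / 2) by apply: sin_gt0_pi; apply/andP; split; lra.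
have := cos2Dsin2 (x / 2); rewrite cosD; nra.
Qed.

(** Two angles of the same point have [cos (y - x) = 1], which [cos_lt1] excludes
    unless they coincide. *)
Lemma angle_expi x : 0 < x < 2 * pi -> angle (expi x) = x.
Proof.
move=> hx; apply: xget_unique; first by split.
move=> y [hy]; rewrite !expiE !cexp_ii => -[ec es].
have c1 : cos (y - x) = 1 by rewrite cosB ec es -!expr2 cos2Dsin2.
move/andP: hx => [x0 x2]; move/andP: hy => [y0 y2].
have [xy|yx|//] := ltgtP x y; exfalso.
- have := @cos_lt1 (y - x); rewrite c1 ltxx => /(_ _)/negP; apply => //.
  by apply/andP; split; lra.
- have := @cos_lt1 (x - y); rewrite -cosN opprB c1 ltxx => /(_ _)/negP; apply => //.
  by apply/andP; split; lra.
Qed.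

Lemma tsym_expi (z : R[i]) x : 0 < x < 2 * pi ->
  tsym z (expi x) = cexp (ii * (z * (x%:C - pi%:C))).
Proof. by move=> hx; rewrite /tsym angle_expi // rmorphB mulrA. Qed.

Let pi0 : 0 < pi :> R. Proof. exact: pi_gt0. Qed.

(** On the upper half circle [x - pi] is negative, so the angle of the shifted point is
    [x + pi]. *)
Lemma phi1_lower beta x : 0 < x < pi -> phi1 beta (expi x) =
  cexp (ii * ((beta - 1 / 2) * (x%:C - pi%:C) + (beta + 1 / 2) * x%:C)).
Proof.
move=> /andP[x0 xp]; have p0 := pi0.
rewrite /phi1 tsym_expi; last by apply/andP; split; lra.
have -> : expi x * expi (- pi) = expi (x + pi).
  rewrite -expiD (_ : x + pi = x - pi + 2 * pi); last by ring.
  by rewrite [RHS]expiD expi_2pi mulr1.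
rewrite tsym_expi; last by apply/andP; split; lra.
by rewrite -cexpD -mulrDr [(x + pi)%:C]rmorphD addrK.
Qed.

Lemma phi1_upper beta x : pi < x < 2 * pi -> phi1 beta (expi x) =
  cexp (ii * ((beta - 1 / 2) * (x%:C - pi%:C) + (beta + 1 / 2) * (x%:C - 2 * pi%:C))).
Proof.
move=> /andP[x0 xp]; have p0 := pi0.
rewrite /phi1 tsym_expi; last by apply/andP; split; lra.
rewrite -expiD tsym_expi; last by apply/andP; split; lra.
by rewrite -cexpD -mulrDr [(x - pi)%:C]rmorphB; congr (cexp (ii * (_ + _ * _))); ring.
Qed.

Lemma cexp_2pi_int (m : int) : cexp (ii * (2 * pi%:C * m%:~R)) = 1.
Proof.
have h1 : cexp (ii * (2 * pi%:C)) = 1.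
  by have := expi_2pi; rewrite expiE [(2 * pi)%:C]rmorphM /= -natC.
have hn (n : nat) : cexp (ii * (2 * pi%:C * n%:R)) = 1.
  by rewrite mulrA mulrC cexp_natM h1 expr1n.
case: m => n; first exact: hn.
by rewrite NegzE rmorphN mulrN mulrN cexpN hn invr1.
Qed.

Lemma cexp_pi : cexp (ii * pi%:C) = -1.
Proof. by rewrite cexp_ii cospi sinpi; apply: complex_ext; rewrite /= ?oppr0. Qed.

Lemma cexp_half_pi : cexp (ii * (pi%:C / 2)) = ii.
Proof.
rewrite (_ : pi%:C / 2 = (pi / 2)%:C); last by rewrite natC -fmorphV -rmorphM.
by rewrite cexp_ii cos_pihalf sin_pihalf.
Qed.

Let line (w e : R[i]) (t : R) : R[i] := cexp (ii * (w * t%:C + e)).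

Let isD_line w e t : isD (line w e) t (ii * w * line w e t).
Proof.
have h : isD (fun s => ii * (w * s%:C + e)) t (ii * (w * 1 + 0)).
  by apply: isD_scale; apply: isD_add; [apply: isD_scale; exact: isD_id|exact: isD_cst].
by apply: isD_eq (isD_cexp h) _; rewrite mulr1 addr0.
Qed.

(** On either half of the circle the integrand is a single exponential. *)
Lemma fourier_phi1_int beta k : cintegral `[0, 2 * pi]
    (fun x => phi1 beta (expi x) * expi (- (k%:~R * x))) =
  let w := 2 * beta - k%:~R in
  let e1 := - ((beta - 1 / 2) * pi%:C) in
  let e2 := - ((3 * beta + 1 / 2) * pi%:C) in
  if w == 0 then pi%:C * (cexp (ii * e1) + cexp (ii * e2))
  else ((line w e1 pi - line w e1 0) + (line w e2 (2 * pi) - line w e2 pi)) / (ii * w).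
Proof.
pose w := 2 * beta - k%:~R.
pose e1 := - ((beta - 1 / 2) * pi%:C); pose e2 := - ((3 * beta + 1 / 2) * pi%:C).
rewrite -/w -/e1 -/e2 /=; have p0 := pi0.
have p2 : pi < 2 * pi :> R by lra.
have f1 t : 0 < t < pi -> phi1 beta (expi t) * expi (- (k%:~R * t)) = line w e1 t.
  move=> ht; rewrite phi1_lower // expiE -cexpD -mulrDr rmorphN rmorphM rmorph_int /line /w /e1.
  by congr (cexp (ii * _)); field.
have f2 t : pi < t < 2 * pi -> phi1 beta (expi t) * expi (- (k%:~R * t)) = line w e2 t.
  move=> ht; rewrite phi1_upper // expiE -cexpD -mulrDr rmorphN rmorphM rmorph_int /line /w /e2.
  by congr (cexp (ii * _)); field.
case: ifPn => [/eqP w0|w0].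
- have lE e t : line w e t = cexp (ii * e) by rewrite /line w0 mul0r add0r.
  have dG e t : isD (fun s => cexp (ii * e) * s%:C) t (line w e t).
    by rewrite lE; apply: isD_eq (isD_scale _ (isD_id _)) _; rewrite mulr1.
  rewrite (cintegral_two_pieces p0 p2 (dG e1) (isD_line w e1) (dG e2) (isD_line w e2) f1 f2).
  by rewrite [(2 * pi)%:C]rmorphM /= -natC; ring.
- have dG e t : isD (fun s => (ii * w)^-1 * line w e s) t (line w e t).
    apply: isD_eq (isD_scale _ (isD_line w e t)) _.
    by rewrite mulrA mulVf ?mul1r // mulf_neq0.
  rewrite (cintegral_two_pieces p0 p2 (dG e1) (isD_line w e1) (dG e2) (isD_line w e2) f1 f2).
  by ring.
Qed.

Let E beta : R[i] := cexp (ii * (beta * pi%:C)).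

Let cexp_e1 beta : cexp (ii * - ((beta - 1 / 2) * pi%:C)) = ii * (E beta)^-1.
Proof.
rewrite -{2}cexp_half_pi -cexpN -cexpD; congr cexp; by field.
Qed.

Let cexp_e2 beta : cexp (ii * - ((3 * beta + 1 / 2) * pi%:C)) = ii^-1 * (E beta)^-1 ^+ 3.
Proof.
rewrite -{2}cexp_half_pi -!cexpN -cexp_natM -cexpD; congr cexp; by field.
Qed.

Let ii2 : ii * ii = -1.
Proof. by apply: complex_ext; rewrite /ii /=; ring. Qed.

Let iiV : ii^-1 = - ii.
Proof. by apply: (mulfI ii0); rewrite mulfV // mulrN ii2 opprK. Qed.

Let E0 beta : E beta != 0. Proof. exact: cexp_neq0. Qed.

Let line_pi (w e : R[i]) : line w e pi = cexp (ii * (w * pi%:C)) * cexp (ii * e).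
Proof. by rewrite /line mulrDr cexpD. Qed.

Let line_0 (w e : R[i]) : line w e 0 = cexp (ii * e).
Proof. by rewrite /line mulr0 add0r. Qed.

Let line_2pi (w e : R[i]) : line w e (2 * pi) = cexp (ii * (w * pi%:C)) ^+ 2 * cexp (ii * e).
Proof.
rewrite /line mulrDr cexpD -cexp_natM; congr (cexp _ * _).
by rewrite [(2 * pi)%:C]rmorphM /= -natC; ring.
Qed.

Let w_even beta (m : int) :
  cexp (ii * ((2 * beta - (2 * m)%:~R) * pi%:C)) = E beta ^+ 2.
Proof.
have -> : ii * ((2 * beta - (2 * m)%:~R) * pi%:C) =
    2%:R * (ii * (beta * pi%:C)) - ii * (2 * pi%:C * m%:~R) by rewrite intrM; ring.
by rewrite cexpD cexpN cexp_2pi_int invr1 mulr1 cexp_natM.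
Qed.

Let w_odd beta (m : int) :
  cexp (ii * ((2 * beta - (2 * m + 1)%:~R) * pi%:C)) = - E beta ^+ 2.
Proof.
have -> : ii * ((2 * beta - (2 * m + 1)%:~R) * pi%:C) =
    ii * ((2 * beta - (2 * m)%:~R) * pi%:C) - ii * pi%:C by rewrite intrD; ring.
by rewrite cexpD w_even cexpN cexp_pi invrN invr1 mulrN1.
Qed.

Let pC0 : (pi : R)%:C != 0.
Proof. by rewrite -normc_gt0 normc_real gtr0_norm. Qed.

Let piC2 : (pi / 2 : R)%:C = pi%:C / 2.
Proof. by rewrite (natC R 2) -fmorphV -rmorphM. Qed.

Let fourierE beta k : fourier (phi1 beta) k = (2 * pi%:C)^-1 *
  cintegral `[0, 2 * pi] (fun x => phi1 beta (expi x) * expi (- (k%:~R * x))).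
Proof. by rewrite /fourier (natC R 2) -rmorphM -fmorphV. Qed.

Lemma fourier_even beta (m : int) : fourier (phi1 beta) (2 * m) = 0.
Proof.
rewrite fourierE fourier_phi1_int /=; case: ifPn => [/eqP w0|w0].
- have E2 : E beta ^+ 2 = 1 by rewrite -(w_even _ m) w0 mul0r mulr0 cexp0.
  rewrite cexp_e1 cexp_e2 iiV exprSr exprVn E2 invr1 mul1r mulNr addrN.
  by rewrite !mulr0.
- rewrite !(line_pi, line_0, line_2pi) w_even cexp_e1 cexp_e2 iiV.
  rewrite [X in _ * (X / _)](_ : _ = 0) ?mul0r ?mulr0 //.
  by move: (E0 beta); move: (E beta) => x x0; field.
Qed.

(** The boundary terms add up to
    [i ((-1)^k - 1) (E + 1/E)] with [E = exp (i pi beta)], which also explains why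
    the even coefficients vanish. *)
Lemma fourier_odd beta (m : int) : 2 * beta != (2 * m + 1)%:~R ->
  fourier (phi1 beta) (2 * m + 1) = cosconst (2 * beta) / ((2 * m + 1)%:~R - 2 * beta).
Proof.
move=> wn0; rewrite fourierE fourier_phi1_int /= subr_eq0 (negbTE wn0).
rewrite !(line_pi, line_0, line_2pi) w_odd cexp_e1 cexp_e2.
rewrite /cosconst /cosb -/ii.
have -> : ii * (2 * beta) * (pi / 2)%:C = ii * (beta * pi%:C).
  by rewrite piC2; field.
rewrite cexpN -/(E beta) piC2.
move: wn0; rewrite -subr_eq0; move: (_%:~R) => K wn0.
have wn1 : K - 2 * beta != 0 by rewrite -opprB oppr_eq0.
move: (E0 beta) pC0 ii0; move: (E beta) (pi%:C) => x P x0 p0 i0.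
have -> : ii^-1 = - ii by exact: iiV.
by field; rewrite wn1 p0 x0 wn0 i0.
Qed.

End Fourier.

(** * The determinant of the symbol *)

Section Assembly.
Variable R : realType.
Variable beta : R[i].
Hypothesis hbeta : forall m : int, beta <> m%:~R + 1 / 2.

Lemma two_beta_not_odd (m : int) : 2 * beta != (2 * m + 1)%:~R.
Proof.
apply/eqP => h; apply: (hbeta (m := m)).
by apply: (@mulfI _ (2 : R[i])); rewrite ?pnatr_eq0 // h intrD intrM; field.
Qed.

Lemma odd_sub_beta (k : nat) : (2 * k + 1)%:R - 2 * beta != 0.
Proof.
rewrite subr_eq0 eq_sym; have := two_beta_not_odd k%:Z.
by rewrite -[(2 * k + 1)%:R]/((2 * k + 1)%:Z%:~R) PoszD PoszM.
Qed.

Lemma odd_add_beta (k : nat) : (2 * k + 1)%:R + 2 * beta != 0.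
Proof.
apply/eqP => h; move/eqP: (two_beta_not_odd (- (k%:Z + 1))); apply.
have -> : 2 * beta = - (2 * k + 1)%:R.
  by apply/eqP; rewrite -addr_eq0 addrC h.
rewrite (_ : 2 * - (k%:Z + 1) + 1 = - (2 * k + 1)%N%:Z); last by lia.
by rewrite rmorphN.
Qed.

(** Of the two coefficients in an entry, the one of odd index survives. *)
Lemma det_Mmx n : \det (Mmx (phi1 beta) n) = detM (2 * beta) (cosconst (2 * beta)) n.
Proof.
rewrite /detM; congr (\det _); apply/matrixP => j k; rewrite !mxE /entry.
have e := odd_double_half (j + k).
have [od|od] := boolP (odd (j + k)).
- have -> : j%:Z - k%:Z = 2 * (((j + k)./2)%:Z - k%:Z) + 1 by rewrite od in e; lia.
  have -> : j%:Z + k%:Z + 1 = 2 * (((j + k)./2)%:Z + 1) by rewrite od in e; lia.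
  rewrite fourier_even addr0 fourier_odd ?two_beta_not_odd //.
  have -> : 2 * (((j + k)./2)%:Z - k%:Z) + 1 = j%:Z - k%:Z by rewrite od in e; lia.
  by rewrite intrB.
- have -> : j%:Z - k%:Z = 2 * (((j + k)./2)%:Z - k%:Z) by rewrite (negbTE od) in e; lia.
  have -> : j%:Z + k%:Z + 1 = 2 * ((j + k)./2)%:Z + 1 by rewrite (negbTE od) in e; lia.
  rewrite fourier_even add0r fourier_odd ?two_beta_not_odd //.
  have -> : 2 * ((j + k)./2)%:Z + 1 = (j + k + 1)%N%:Z by rewrite (negbTE od) in e; lia.
  by [].
Qed.

End Assembly.

Theorem theorem7p3 (R : realType) (beta : R[i])
    (hbeta : forall m : int, beta <> m%:~R + 1 / 2) :
  asymp (fun n : nat => \det (Mmx (phi1 beta) n))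
    (fun n : nat =>
       cpow (n%:R : R) (- (1 / 4) - 3 * beta ^+ 2)
       * cpow (2 : R) (4 * beta ^+ 2)
       * barnesG (1 - 2 * beta) * barnesG (1 / 2 + beta)
       * barnesG (3 / 2 + beta))
  /\ (forall n : nat,
        \det (Mmx (phi1 beta) n) = 0 <->
        exists m : nat, [/\ (1 <= m)%N, beta = m%:R & (2 * m + 1 <= n)%N]).
Proof.
have hB := odd_sub_beta hbeta; have hD := odd_add_beta hbeta.
split.
  have -> : (fun n => \det (Mmx (phi1 beta) n)) =
      detM (2 * beta) (cosconst (2 * beta)).
    by apply/funext => n; rewrite det_Mmx.
  exact: detM_asymp hB hD (costrunc_cosconst hB hD).
move=> n; rewrite det_Mmx //.
apply: (iff_trans (rwP eqP)); rewrite detM_eq0 ?cosconst_neq0 //; split.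
- case/existsP => -[i j] /= /and3P[ij od /eqP e].
  have [s sE] : exists s, (i + j + 1 = 2 * s)%N by exists (i + j + 1)./2; lia.
  have es : 2 * beta = s%:R.
    by apply: (@mulfI _ (2 : R[i])); rewrite ?pnatr_eq0 // -e sE natrM.
  have [m mE] : exists m, s = (2 * m)%N.
    exists s./2; case: (boolP (odd s)) => os; last by lia.
    have := two_beta_not_odd hbeta (s./2)%:Z; rewrite es => /eqP; case.
    rewrite (_ : 2 * (s./2)%:Z + 1 = s%:Z) //; lia.
  exists m; split; [lia| |by have := ltn_ord j; lia].
  by apply: (@mulfI _ (2 : R[i])); rewrite ?pnatr_eq0 // es mE natrM.
- case=> m [m1 -> mn]; apply/existsP.
  have h1 : (2 * m - 1 < n)%N by lia.
  have h2 : (2 * m < n)%N by lia.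
  exists (Ordinal h1, Ordinal h2); apply/and3P; split => /=; [lia|lia|].
  by rewrite -!natrM eqr_nat; lia.
Qed.
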